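(* Let $\psi\in C^1(\mathbb{R}^2,\mathbb{R}^2)$, let $\phi\in C(\mathbb{R}\times\mathbb{R}^2\times[0,1],\mathbb{R}^2)$ be $T$-periodic in its first variable, and assume that $\dot x=\psi(x)$ has a limit cycle $x_0$ of smallest period $T>0$ such that the linearized system $\dot y=\psi'(x_0(t))y$ has only one characteristic multiplier equal to $1$. Assume that there is $\theta_0\in[0,T]$ such that, for all sufficiently small $\varepsilon>0$, the system $\dot x=\psi(x)+\varepsilon\phi(t,x,\varepsilon)$ has a $T$-periodic solution $x_\varepsilon$ satisfying $x_\varepsilon(t-\theta_0)\to x_0(t)$ as $\varepsilon\to0$ for any $t\in[0,T]$. Then there exist $\varepsilon_0>0$, $r_0\in(0,1]$ and functions $\theta_\varepsilon:[0,T]\to\mathbb{R}$, $\varepsilon\in(0,\varepsilon_0)$, such that for every $t\in[0,T]$ with $f_1(\theta_0,t)=0$ we have $$\left\|x_\varepsilon(t-\theta_\varepsilon(t))-x_0(t)\right\|=o(\varepsilon),$$ where $\theta_\varepsilon(t)\to\theta_0$ as $\varepsilon\to0$ and $x_\varepsilon(t-\theta_\varepsilon(t))\in I(t,[-r_0,r_0])$.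
   Context: An eigenfunction of a linear $T$-periodic system corresponding to a characteristic multiplier $\rho$ is a nontrivial solution $y$ with $y(t+T)=\rho\,y(t)$. ''Only one characteristic multiplier equal to $1$'' means that $1$ is a simple multiplier. The functions $z_0$ and $z_1$ are eigenfunctions of the adjoint system $\dot z=-(\psi'(x_0(t)))^*z$ ($*$ = transpose) corresponding to the characteristic multipliers $1$ and $\rho_*\neq1$ respectively. Define $$f_1(\theta,s)=\int_{s-T}^s\langle z_1(\tau),\phi(\tau-\theta,x_0(\tau),0)\rangle\,d\tau .$$ For $a\in\mathbb{R}^2$, $a^\bot$ is $a$ rotated clockwise by $\pi/2$. $\Omega(\cdot,t_0,\xi)$ is the solution of $\dot x=\psi(x)$ with $x(t_0)=\xi$. For $t,r\in\mathbb{R}$ put $$h(t,r)=x_0(t)+r\,\frac{z_0(t)^\bot}{\|z_0(t)^\bot\|},\qquad I(t,r)=\Omega(T,0,h(t,r)),$$ (wherever the solution exists on $[0,T]$), and $I(t,[-r_0,r_0])=\{I(t,r):r\in[-r_0,r_0]\}$. The symbol $o(\varepsilon)$ denotes a function of $\varepsilon$ (possibly depending also on $t$) with $o(\varepsilon)/\varepsilon\to0$ as $\varepsilon\to0$ uniformly in $t$. *)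

(* Defs.v *)
(* R is an arbitrary realType.
   Points of the plane are row vectors 'rV[R]_2.  For row vectors the library's
   jacobian satisfies 'd psi p v = v *m jacobian psi p, so (jacobian psi p)^T
   is the usual matrix psi'(p) acting on columns. *)
From HB Require Import structures.
From mathcomp Require Import all_boot all_order all_algebra.
From mathcomp Require Import all_classical all_reals all_analysis.

Set Implicit Arguments.
Unset Strict Implicit.
Unset Printing Implicit Defensive.

Import Order.TTheory GRing.Theory Num.Theory.
Import numFieldNormedType.Exports.

Local Open Scope classical_set_scope.
Local Open Scope ring_scope.

Section Plane.
Variable R : realType.
Implicit Types u v a : 'rV[R]_2.

Definition dot u v : R := \sum_(i < 2) u 0 i * v 0 i.

(* The library norm `|v| on matrices is the sup norm. *)
Definition enorm v : R := Num.sqrt (dot v v).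

(* Clockwise rotation by pi/2: (a_0, a_1) |-> (a_1, - a_0). *)
Definition perp a : 'rV[R]_2 :=
  \row_(j < 2) if j == 0 then a 0 1 else - a 0 0.

End Plane.

Section Systems.
Variable R : realType.
Implicit Types (psi : 'rV[R]_2 -> 'rV[R]_2) (x y z : R -> 'rV[R]_2).
Implicit Types (A : R -> 'M[R]_2) (T t r rho : R).

Definition C1 psi : Prop :=
  (forall p, differentiable psi p) /\ continuous (jacobian psi).

Definition solution psi x : Prop :=
  forall t, is_derive t (1 : R) x (psi (x t)).

Definition closed_orbit_of_period psi T x : Prop :=
  [/\ solution psi x, 0 < T, periodic x T
    & forall S, 0 < S < T -> ~ periodic x S].

(* A limit cycle is an isolated closed orbit. The minimality of T > 0 already
   forces the closed orbit to be nonconstant. *)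
Definition limit_cycle psi T x : Prop :=
  closed_orbit_of_period psi T x /\
  exists U : set 'rV[R]_2,
    [/\ open U, range x `<=` U
      & forall S y, closed_orbit_of_period psi S y ->
          range y `<=` U -> range y = range x].

(* p is the value at time t of the solution of x' = psi x with x(t0) = xi;
   no p is related if that solution does not exist up to time t. *)
Definition Omega psi t t0 (xi p : 'rV[R]_2) : Prop :=
  exists (a b : R) (u : R -> 'rV[R]_2),
    [/\ a < t0 < b, a < t < b,
        forall s, a < s < b -> is_derive s (1 : R) u (psi (u s)),
        u t0 = xi & u t = p].

(* In column notation this is y' = A(t)^T y. *)
Definition linear_solution A y : Prop :=
  forall t, is_derive t (1 : R) y (y t *m A t).

Definition fundamental_matrix A (Y : R -> 'M[R]_2) : Prop :=
  Y 0 = 1%:M /\ forall t, is_derive t (1 : R) Y (Y t *m A t).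

(* The characteristic multipliers are the eigenvalues of the monodromy matrix
   Y(T), counted with algebraic multiplicity. *)
Definition simple_multiplier A T rho : Prop :=
  exists2 Y, fundamental_matrix A Y & mup rho (char_poly (Y T)) = 1%N.

Definition eigenfunction A T rho y : Prop :=
  [/\ linear_solution A y, exists t, y t != 0
    & forall t, y (t + T) = rho *: y t].

(* y' = psi'(x(t)) y *)
Definition linearized psi x : R -> 'M[R]_2 := fun t => jacobian psi (x t).

(* z' = - (psi'(x(t)))^* z *)
Definition adjoint psi x : R -> 'M[R]_2 := fun t => - (jacobian psi (x t))^T.

Definition f1 (phi : R -> 'rV[R]_2 -> R -> 'rV[R]_2) x0 z1 T (theta s : R) : R :=
  (\int[lebesgue_measure]_(tau in `[s - T, s])
     dot (z1 tau) (phi (tau - theta) (x0 tau) 0))%R.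

Definition h x0 z0 t r : 'rV[R]_2 :=
  x0 t + r *: ((enorm (perp (z0 t)))^-1 *: perp (z0 t)).

(* The curve I(t, [-r0, r0]), where I(t, r) = Omega(T, 0, h(t, r)) whenever the
   latter is defined. *)
Definition I_curve psi x0 z0 T t (r0 : R) : set 'rV[R]_2 :=
  [set p | exists2 r, - r0 <= r <= r0 & Omega psi T 0 (h x0 z0 t r) p].

End Systems.

(* Main.v *)
(* Work with u_eps(t) = x_eps(t - theta0), which converges uniformly to x0 by
   Gronwall's inequality.  A point p near x0(t) lies on the curve I(t, .) iff
   its backward trajectory at time -T lies on the normal segment through x0(t),
   i.e. iff <z0(t), Omega(-T, 0, p) - x0(t)> = 0.  For p = u_eps(t + s) this is
   a scalar equation in s; since <z0, psi(x0)> is a nonzero constant, the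
   intermediate value theorem gives a root s near 0, uniformly in t, and
   theta_eps(t) = theta0 - s.

   Let w(r) = u_eps(r + s) - x0(r).  Because z0 solves the adjoint equation,
   <z0(t), w(t)> = o(|w(t)|).  Differentiating <z1, w> and integrating over a
   period gives (1 - 1/rho) <z1(t), w(t)> = eps f1(theta0, t) + o(|w(t)| + eps),
   where f1(theta0, t) = 0.  As z0(t) and z1(t) are independent, |w(t)| is
   o(|w(t)| + eps), hence o(eps). *)
Require Import Defs.
From HB Require Import structures.
From mathcomp Require Import all_boot all_order all_algebra.
From mathcomp Require Import all_classical all_reals all_analysis.
From mathcomp Require Import ring lra.

Set Implicit Arguments.
Unset Strict Implicit.
Unset Printing Implicit Defensive.

Import Order.TTheory GRing.Theory Num.Theory.
Import numFieldNormedType.Exports.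

Local Open Scope classical_set_scope.
Local Open Scope ring_scope.

(** * Mean value inequalities *)

(** Since [psi] is only C1 and [phi] only continuous, no flow map differentiable in its initial
    point is built. Its role is taken by Gronwall's inequality with explicit constants and by a
    first-order Taylor bound uniform on a ball. Backward trajectories might a priori fail to last
    for time T, so [psi] is cut off outside a ball containing the unit tube around the orbit; the
    cut-off field has global trajectories. The two pairings are estimated along different curves.
    For [z0] it is the unperturbed trajectory through [u(t + s)]: the crossing condition makes the
    pairing vanish exactly one period earlier, so no term in eps arises. For [z1] it is the periodic
    perturbed solution, where eps enters through [f1] up to small errors. The root given by the
    intermediate value theorem may be neither unique nor continuous in t. It is chosen in a fixed
    interval [[-delta, delta]], and every root there is shown to be small; hence one choice of
    [theta] serves all accuracies [eta]. *)

Lemma compact_unif_continuous (R : realType) (U V : normedModType R)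
    (f : U -> V) (A : set U) (e : R) :
  compact A -> continuous f -> 0 < e ->
  exists2 d, 0 < d & forall x y, A x -> `|x - y| < d -> `|f x - f y| < e.
Proof.
move=> /compact_near_coveringP cA cf e0.
(* Near-covering compactness: each [x] admits one radius good for all nearby centres, and
   compactness makes it uniform. Only the first point is confined to [A]. *)
have [x Ax|d /= d0 H] := cA R (0^'+)
  (fun d x => forall y, `|x - y| < d -> `|f x - f y| < e) _.
  have e20 : 0 < e / 2 by rewrite divr_gt0.
  have /cvgrPdist_lt/(_ _ e20)/nbhs_normP[d /= d0 xd] := cf x.
  have d20 : 0 < d / 2 by rewrite divr_gt0.
  exists ([set y | `|x - y| < d / 2], [set r | 0 < r < d / 2]) => /=.
    split; first by apply/nbhs_normP; exists (d / 2).
    exists (d / 2) => //= r /=; rewrite sub0r normrN => rd r0.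
    by rewrite r0 (le_lt_trans (ler_norm r)).
  move=> [x' r] /= [xx' /andP[r0 rd]] y x'y.
  have xy : `|x - y| < d by have := ler_distD x' x y; lra.
  have x'd : `|x - x'| < d by lra.
  have h1 : `|f x - f y| < e / 2 := xd _ xy.
  have h2 : `|f x - f x'| < e / 2 := xd _ x'd.
  have := ler_distD (f x) (f x') (f y).
  rewrite (distrC (f x') (f x)); lra.
have d20 : 0 < d / 2 by rewrite divr_gt0.
exists (d / 2) => // x y Ax xy; apply: (H (d / 2) _ _ x Ax) => //=.
by rewrite sub0r normrN gtr0_norm//; lra.
Qed.

Section Coordinates.
Variables (R : realType) (n : nat).
Implicit Types (v : 'rV[R]_n) (f : R -> 'rV[R]_n).

Lemma coord_norm_le v i : `|v 0 i| <= `|v|.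
Proof.
rewrite [leRHS]/Num.Def.normr/= mx_normrE.
by apply: le_trans (le_bigmax _ _ (0, i)).
Qed.

Lemma row_norm_le v c : 0 <= c -> (forall i, `|v 0 i| <= c) -> `|v| <= c.
Proof.
move=> c0 vc; rewrite [leLHS]/Num.Def.normr/= mx_normrE bigmax_le// => -[i j] _ /=.
by rewrite ord1.
Qed.

Lemma is_derive_coord f (df : 'rV[R]_n) t i : is_derive t (1 : R) f df ->
  is_derive t (1 : R) (fun s => f s 0 i) (df 0 i).
Proof.
move=> [fd <-]; have fdi := (derivable_mxP f t 1).1 fd.
by apply: DeriveDef => //; rewrite derive_mx// mxE.
Qed.

Lemma is_derive_row f (df : 'rV[R]_n) t :
  (forall i, is_derive t (1 : R) (fun s => f s 0 i) (df 0 i)) ->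
  is_derive t (1 : R) f df.
Proof.
move=> fdi; have fd : derivable f t 1.
  by apply/derivable_mxP => i j; rewrite ord1.
by apply: DeriveDef => //; rewrite derive_mx//; apply/rowP => j; rewrite mxE derive_val.
Qed.

End Coordinates.

Section MeanValue.
Variable R : realType.

Lemma is_derive_continuous (V : normedModType R) (f : R -> V) t df :
  is_derive t (1 : R) f df -> {for t, continuous f}.
Proof. by move=> [fd _]; apply/differentiable_continuous/derivable1_diffP. Qed.

Lemma derive_le_sub (f g df dg : R -> R) (a b : R) : a <= b ->
  (forall t, a <= t <= b -> is_derive t (1 : R) f (df t)) ->
  (forall t, a <= t <= b -> is_derive t (1 : R) g (dg t)) ->
  (forall t, a < t < b -> df t <= dg t) ->
  f b - f a <= g b - g a.
Proof.
rewrite le_eqVlt => /predU1P[->|ab] fd gd dfg; first by rewrite !subrr.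
have hd t : a <= t <= b -> is_derive t (1 : R) (g - f) (dg t - df t).
  by move=> tab; have := fd _ tab; have := gd _ tab => *; exact: is_deriveB.
have [|||c cab E] := @MVT R (g - f) (fun t => dg t - df t) a b.
- exact: ab.
- by move=> t /[!in_itv]/= /andP[/ltW ? /ltW ?]; apply: hd; apply/andP.
- apply: derivable_within_continuous => t /[!in_itv]/= /hd []//.
rewrite in_itv/= in cab.
have : 0 <= (dg c - df c) * (b - a) by rewrite mulr_ge0// subr_ge0 ?dfg// ltW.
by rewrite -E /= !fctE; lra.
Qed.

(** With the sup norm, the scalar comparison applied to each coordinate and its negative loses no
    factor. *)
Lemma norm_derive_le_sub n (f df : R -> 'rV[R]_n) (g dg : R -> R) (a b : R) :
  a <= b ->
  (forall t, a <= t <= b -> is_derive t (1 : R) f (df t)) ->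
  (forall t, a <= t <= b -> is_derive t (1 : R) g (dg t)) ->
  (forall t, a < t < b -> `|df t| <= dg t) ->
  `|f b - f a| <= g b - g a.
Proof.
move=> ab fd gd dfg.
have nfd i t : a <= t <= b -> is_derive t (1 : R) (fun t => - f t 0 i) (- df t 0 i).
  by move=> tab; have := is_derive_coord i (fd _ tab) => *; exact: is_deriveN.
have dfi t i : a < t < b -> - dg t <= df t 0 i <= dg t.
  by move=> tab; rewrite -ler_norml (le_trans (coord_norm_le _ _))// dfg.
have bound i : `|f b 0 i - f a 0 i| <= g b - g a.
  rewrite ler_norml; apply/andP; split; last first.
    apply: (derive_le_sub (f := fun t => f t 0 i) (df := fun t => df t 0 i)) gd _ => //.
      by move=> t /fd/(is_derive_coord i).
    by move=> t /(dfi _ i)/andP[].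
  have : - f b 0 i - - f a 0 i <= g b - g a; last by lra.
  apply: (derive_le_sub (f := fun t => - f t 0 i) (df := fun t => - df t 0 i)) gd _ => //.
  by move=> t /(dfi _ i)/andP[? ?]; lra.
(* In dimension 0 no coordinate supplies [0 <= g b - g a], so [g] is compared with the constant
   0. *)
case: n f df fd dfg nfd dfi bound => [|n] f df fd dfg nfd dfi bound.
  rewrite [f b - f a]thinmx0 normr0.
  have := @derive_le_sub (cst 0) g (cst 0) dg a b ab _ gd.
  rewrite subrr; apply => t tab /=; by [|rewrite (le_trans _ (dfg _ tab))].
apply: row_norm_le => [|i]; first exact: le_trans (bound ord0).
by rewrite !mxE.
Qed.

Lemma is_derive_scale (V : normedModType R) (v : V) t :
  is_derive t (1 : R) (fun s : R => s *: v) v.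
Proof.
have E : (fun h : R => h^-1 *: (((fun s : R => s *: v) \o shift t) (h *: (1 : R)) -
    t *: v)) @ 0^' --> v.
  apply: cvg_near_cst; near=> h; rewrite /= [X in (X + t) *: v]mulr1 scalerDl addrK scalerA.
  by rewrite mulVf ?scale1r//; near: h; exact: nbhs_dnbhs_neq.
by split; [apply/cvg_ex; exists v | apply/cvg_lim].
Unshelve. all: by end_near. Qed.

Lemma norm_derive_le n (f df : R -> 'rV[R]_n) (a b K : R) : a <= b ->
  (forall t, a <= t <= b -> is_derive t (1 : R) f (df t)) ->
  (forall t, a < t < b -> `|df t| <= K) ->
  `|f b - f a| <= K * (b - a).
Proof.
move=> ab fd fK.
have := norm_derive_le_sub ab fd (fun t _ => is_derive_scale (K : R^o) t) fK.
by rewrite /GRing.scale/= -mulrBl mulrC.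
Qed.

Lemma abs_derive_le (f df : R -> R) (a b K : R) : a <= b ->
  (forall t, a <= t <= b -> is_derive t (1 : R) f (df t)) ->
  (forall t, a < t < b -> `|df t| <= K) ->
  `|f b - f a| <= K * (b - a).
Proof.
move=> ab fd fK.
pose F t : 'rV[R]_1 := \row_i f t; pose dF t : 'rV[R]_1 := \row_i df t.
have Fd t : a <= t <= b -> is_derive t (1 : R) F (dF t).
  move=> tab; apply: is_derive_row => i; rewrite mxE.
  by rewrite (_ : (fun s => _) = f); [exact: fd|apply/funext => s; rewrite mxE].
have FK t : a < t < b -> `|dF t| <= K.
  move=> tab; apply: row_norm_le => [|i]; first exact: le_trans (fK t tab).
  by rewrite mxE fK.
have := norm_derive_le ab Fd FK; apply: le_trans.
by have := coord_norm_le (F b - F a) 0; rewrite !mxE.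
Qed.

End MeanValue.

(** * Gronwall's inequality *)

Section Dot.
Variable R : realType.
Implicit Types u v w : 'rV[R]_2.

Lemma dotE u v : dot u v = u 0 0 * v 0 0 + u 0 1 * v 0 1.
Proof.
by rewrite /dot big_ord_recl big_ord1; congr (_ + u 0 _ * v 0 _); exact/val_inj.
Qed.

Lemma dotC u v : dot u v = dot v u.
Proof. by rewrite !dotE; ring. Qed.

Lemma dotDr u v w : dot u (v + w) = dot u v + dot u w.
Proof. by rewrite !dotE !mxE; ring. Qed.

Lemma dotNr u v : dot u (- v) = - dot u v.
Proof. by rewrite !dotE !mxE; ring. Qed.

Lemma dotBr u v w : dot u (v - w) = dot u v - dot u w.
Proof. by rewrite dotDr dotNr. Qed.

Lemma dotZr u c v : dot u (c *: v) = c * dot u v.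
Proof. by rewrite !dotE !mxE; ring. Qed.

Lemma dotNl u v : dot (- u) v = - dot u v.
Proof. by rewrite dotC dotNr dotC. Qed.

Lemma dotZl u c v : dot (c *: u) v = c * dot u v.
Proof. by rewrite dotC dotZr dotC. Qed.

Lemma dot_mulmx_tr u v (A : 'M[R]_2) : dot (u *m A^T) v = dot u (v *m A).
Proof.
rewrite !dotE !mxE !(big_ord_recl, big_ord0) !mxE /=.
have -> : (lift ord0 ord0 : 'I_2) = 1 by exact/val_inj.
have -> : (ord0 : 'I_2) = 0 by exact/val_inj.
by ring.
Qed.

Lemma norm_le_dot u : `|u| ^+ 2 <= dot u u.
Proof.
have [u0 u1] := (sqr_ge0 (u 0 0), sqr_ge0 (u 0 1)).
have d0 : 0 <= dot u u by rewrite dotE; nra.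
rewrite -(sqr_sqrtr d0) lerXn2r ?nnegrE ?sqrtr_ge0//.
apply: row_norm_le => [|i]; first exact: sqrtr_ge0.
rewrite -sqrtr_sqr ler_wsqrtr// dotE -!expr2.
case: (unliftP 0 i) => [j|] ->; last by rewrite lerDl.
have -> : lift 0 j = 1 :> 'I_2 by rewrite ord1; exact/val_inj.
by rewrite lerDr.
Qed.

Lemma dot_norm_le u v : `|dot u v| <= 2 * `|u| * `|v|.
Proof.
rewrite dotE (le_trans (ler_normD _ _))// !normrM.
have := ler_pM (normr_ge0 _) (normr_ge0 _) (coord_norm_le u 0) (coord_norm_le v 0).
have := ler_pM (normr_ge0 _) (normr_ge0 _) (coord_norm_le u 1) (coord_norm_le v 1).
lra.
Qed.

Lemma dot_self_le u : dot u u <= 2 * `|u| ^+ 2.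
Proof. by have := dot_norm_le u u; have := ler_norm (dot u u); lra. Qed.

Lemma enorm_le u : enorm u <= 2 * `|u|.
Proof.
rewrite -[leRHS]ger0_norm ?mulr_ge0// -sqrtr_sqr ler_wsqrtr//.
by have := dot_self_le u; have := sqr_ge0 `|u|; lra.
Qed.

Lemma is_derive_dot (f g : R -> 'rV[R]_2) df dg t :
  is_derive t (1 : R) f df -> is_derive t (1 : R) g dg ->
  is_derive t (1 : R) (fun s => dot (f s) (g s)) (dot df (g t) + dot (f t) dg).
Proof.
move=> fd gd.
have -> : (fun s => dot (f s) (g s)) =
    (fun s => f s 0 0) * (fun s => g s 0 0) + (fun s => f s 0 1) * (fun s => g s 0 1).
  by apply/funext => s; rewrite dotE.
have f0 := is_derive_coord 0 fd; have f1 := is_derive_coord 1 fd.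
have g0 := is_derive_coord 0 gd; have g1 := is_derive_coord 1 gd.
apply: (is_derive_eq (is_deriveD (is_deriveM f0 g0) (is_deriveM f1 g1))).
by rewrite !dotE /GRing.scale /= (mulrC (df 0 0)) (mulrC (df 0 1)) addrACA addrC.
Qed.

End Dot.

Section Gronwall.
Variable R : realType.

(** The rate [4 * L + 2] is that of [dot w w + m^2] in [gronwall]: 4 from [dot_norm_le] and the
    derivative of a square, 2 from [4 x m <= 2 x^2 + 2 m^2]. The leading 2 pays for the passage
    between the norms; the square root of the exponential is bounded by the exponential itself. *)
Definition gron (L s : R) : R := 2 * expR ((4 * L + 2) * s).

Lemma gron_ge0 L s : 0 <= gron L s.
Proof. by rewrite mulr_ge0 ?expR_ge0. Qed.

Lemma ler_gron L s t : 0 <= L -> s <= t -> gron L s <= gron L t.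
Proof. by move=> L0 st; rewrite ler_pM2l// ler_expR ler_wpM2l//; lra. Qed.

(** The sup norm is not differentiable, but [dot w w + m^2] is, and its summand [m^2] absorbs the
    inhomogeneous term. Damped by an exponential, it does not increase. *)
Lemma gronwall (w dw : R -> 'rV[R]_2) (a b L m : R) :
  a <= b -> 0 <= L -> 0 <= m ->
  (forall t, a <= t <= b -> is_derive t (1 : R) w (dw t)) ->
  (forall t, a < t < b -> `|dw t| <= L * `|w t| + m) ->
  `|w b| <= gron L (b - a) * (`|w a| + m).
Proof.
move=> ab L0 m0 wd dwle; pose K := 4 * L + 2.
pose q t := dot (w t) (w t) + m ^+ 2.
have qd t : a <= t <= b -> is_derive t (1 : R) q (2 * dot (w t) (dw t)).
  move=> /wd wdt; have wwd := is_derive_dot wdt wdt.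
  rewrite (_ : q = (fun t => dot (w t) (w t)) + cst (m ^+ 2)); last exact/funext.
  by apply: is_derive_eq; rewrite addr0 dotC; ring.
have ed t : is_derive t (1 : R) (fun t => expR (- K * (t - a))) (- K * expR (- K * (t - a))).
  have h : is_derive t (1 : R) (fun t => - K * (t - a)) (- K).
    rewrite (_ : (fun t => _) = - K *: (id - cst a)); last exact/funext.
    by apply: is_derive_eq; rewrite subr0 /GRing.scale/= mulr1.
  by apply: is_derive_eq; rewrite mulrC.
pose G t := expR (- K * (t - a)) * q t.
have Gd t : a <= t <= b -> is_derive t (1 : R) G
   (expR (- K * (t - a)) * (2 * dot (w t) (dw t) - K * q t)).
  move=> /qd qdt; rewrite (_ : G = (fun t => expR (- K * (t - a))) * q); last exact/funext.
  by apply: is_derive_eq; rewrite /GRing.scale/=; ring.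
have : G b - G a <= cst 0 b - cst 0 a.
  apply: (derive_le_sub ab Gd) => // t tab.
  rewrite pmulr_rle0 ?expR_gt0// subr_le0.
  have := dot_norm_le (w t) (dw t); have := ler_norm (dot (w t) (dw t)).
  have := dwle t tab; have := norm_le_dot (w t); rewrite /q /K.
  have := normr_ge0 (w t); have := normr_ge0 (dw t).
  set x := `|w t|; set y := `|dw t|; set d := dot _ _; set e := dot _ _.
  move=> y0 x0 xd yle de exy.
  have : x * y <= x * (L * x + m) by rewrite ler_wpM2l.
  have : L * x ^+ 2 <= L * d by rewrite ler_wpM2l.
  have : 0 <= L * m ^+ 2 by rewrite mulr_ge0 ?sqr_ge0.
  have := sqr_ge0 (x - m).
  nra.
rewrite subrr subr_le0 /G subrr mulr0 expR0 mul1r => Gba.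
have qb : q b <= expR (K * (b - a)) * q a.
  rewrite -[leLHS]mul1r -[X in X * _](expRxMexpNx_1 (K * (b - a))) -mulrA.
  by rewrite ler_pM2l ?expR_gt0// -mulNr.
rewrite /gron -/K; set E := expR _ in qb *.
have E1 : 1 <= E.
  by rewrite -expR0 ler_expR mulr_ge0 ?subr_ge0// /K; lra.
have := norm_le_dot (w b); have := dot_self_le (w a); move: qb; rewrite /q.
have := normr_ge0 (w a).
set x := `|w a|; set y := `|w b| => x0 qb qa yb.
rewrite -(@ler_pXn2r _ 2) ?nnegrE ?normr_ge0//; last by rewrite mulr_ge0//; lra.
have xm : 0 <= (x + m) ^+ 2 by exact: sqr_ge0.
have : dot (w a) (w a) + m ^+ 2 <= 4 * (x + m) ^+ 2 by have := mulr_ge0 x0 m0; nra.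
move=> H; have : E * (dot (w a) (w a) + m ^+ 2) <= E * (4 * (x + m) ^+ 2).
  by rewrite ler_wpM2l//; lra.
have : E * (4 * (x + m) ^+ 2) <= E * (E * (4 * (x + m) ^+ 2)).
  by rewrite ler_wpM2l ?ler_peMl//; lra.
have := sqr_ge0 m; rewrite !exprMn; nra.
Qed.

Lemma gronwall_both (w dw : R -> 'rV[R]_2) (L m : R) : 0 <= L -> 0 <= m ->
  (forall t, is_derive t (1 : R) w (dw t)) ->
  (forall t, `|dw t| <= L * `|w t| + m) ->
  forall a b, `|w b| <= gron L `|b - a| * (`|w a| + m).
Proof.
move=> L0 m0 wd dwle a b; case: (leP a b) => ab.
  by rewrite ger0_norm ?subr_ge0//; apply: gronwall => // t _.
have wNd t : is_derive t (1 : R) (w \o -%R) (- dw (- t)).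
  apply: is_derive_row => i.
  have h := is_derive_coord i (wd (- t)).
  rewrite (_ : (fun s => _) = (fun s => w s 0 i) \o -%R); last exact/funext.
  rewrite mxE -[- _]mulrN1.
  exact: (@is_derive1_comp R (fun s => w s 0 i) -%R t _ (-1) h _).
have wNdle t : - a < t < - b -> `|- dw (- t)| <= L * `|(w \o -%R) t| + m.
  by move=> _; rewrite normrN; exact: dwle.
have ba : - a <= - b by rewrite lerN2 ltW.
have := gronwall ba L0 m0 (fun t _ => wNd t) wNdle.
by rewrite /= !opprK ltr0_norm ?subr_lt0// opprB (addrC (- b)).
Qed.

(* The differential inequality is only known while [w] stays in the unit ball;
   the bound itself keeps [w] there. *)
Lemma gronwall_bootstrap (w dw : R -> 'rV[R]_2) (a b L m : R) :
  0 <= L -> 0 <= m ->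
  (forall t, is_derive t (1 : R) w (dw t)) ->
  (forall t, a <= t <= b -> `|w t| <= 1 -> `|dw t| <= L * `|w t| + m) ->
  gron L (b - a) * (`|w a| + m) < 1 ->
  forall t, a <= t <= b -> `|w t| <= gron L (b - a) * (`|w a| + m).
Proof.
move=> L0 m0 wd dwle small.
have wam : 0 <= `|w a| + m by rewrite addr_ge0.
have step t : a <= t <= b -> (forall s, a < s < t -> `|w s| <= 1) ->
    `|w t| <= gron L (b - a) * (`|w a| + m).
  move=> /andP[a_t tb] w1; apply: (@le_trans _ _ (gron L (t - a) * (`|w a| + m))).
    apply: gronwall => // s /andP[as_ st].
  by apply: dwle; [lra | apply: w1; lra].
  by rewrite ler_wpM2r// ler_gron//; lra.
move=> t tab; apply: (step t tab) => s0 s0at; rewrite leNgt; apply/negP => ws0.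
have cw : continuous (fun s => `|w s|).
  move=> s; apply: (@continuous_comp _ _ _ w (@Num.norm _ _)).
    exact: is_derive_continuous (wd s).
  exact: norm_continuous.
(* The minimum [c] of [A] is the first time the norm reaches 1. Before [c] the inequality is
   available, so the bound, which is below 1, holds at [c]: a contradiction. *)
pose A := `[a, s0] `&` (fun s => `|w s|) @^-1` [set x | 1 <= x].
have cA : compact A.
  apply: compact_closedI; first exact: segment_compact.
  by apply: preimage_closed; [move=> s _; exact: cw | exact: closed_ge].
have A0 : A !=set0 by exists s0; split; rewrite /= ?in_itv/=; lra.
have cid : continuous (idfun : R -> R) by move=> s; exact: cvg_id.
have [c] := compact_EVT_min A0 cA (continuous_subspaceT cid).
rewrite inE/= => -[]; rewrite /= in_itv/= => acs wc cmin.
have : `|w c| <= gron L (b - a) * (`|w a| + m).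
  apply: step => [|s asc]; first by lra.
  rewrite leNgt; apply/negP => ws.
  have : c <= s by apply: cmin; rewrite inE; split; rewrite /= ?in_itv/=; lra.
  lra.
lra.
Qed.

End Gronwall.

(** * Existence of trajectories *)

Section Primitive.
Variable R : realType.

Lemma eq_derive_eq (f g df : R -> R) (a b : R) : a <= b ->
  (forall t, a <= t <= b -> is_derive t (1 : R) f (df t)) ->
  (forall t, a <= t <= b -> is_derive t (1 : R) g (df t)) ->
  f b - f a = g b - g a.
Proof.
move=> ab fd gd; apply/eqP; rewrite eq_le; apply/andP; split.
  exact: derive_le_sub ab fd gd _.
exact: derive_le_sub ab gd fd _.
Qed.

Lemma local_primitive (f : R -> R) (B : R) : continuous f ->
  exists2 F : R -> R, F 0 = 0 &
    forall t, - B < t < B -> is_derive t (1 : R) F (f t).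
Proof.
move=> cf; pose F t := (\int[lebesgue_measure]_(s in `[- B, t]) f s)%R.
exists (F - cst (F 0)) => [|t /andP[Bt tB]]; first by rewrite !fctE subrr.
have fi : (@lebesgue_measure R).-integrable `[- B, B] (EFin \o f).
  apply: continuous_compact_integrable; first exact: segment_compact.
  exact: continuous_subspaceT.
have [Fd FE] := continuous_FTC1_closed tB fi Bt (cf t).
have Fdt : is_derive t (1 : R) F (f t) by apply: DeriveDef => //; rewrite -FE derive1E.
by apply: is_derive_eq; rewrite subr0.
Qed.

Lemma scalar_primitive (f : R -> R) : continuous f ->
  exists2 F : R -> R, F 0 = 0 & forall t, is_derive t (1 : R) F (f t).
Proof.
move=> cf; have /choice[F FP] : forall B : R, exists F : R -> R, F 0 = 0 /\
    forall t, - B < t < B -> is_derive t (1 : R) F (f t).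
  by move=> B; have [F ? ?] := local_primitive B cf; exists F.
have agree B C t : `|t| < B -> `|t| < C -> F B t = F C t.
  rewrite !ltr_norml => tB tC.
  have [[FB0 FB] [FC0 FC]] := (FP B, FP C).
  have -> : F B t = F B t - F B 0 by rewrite FB0 subr0.
  have -> : F C t = F C t - F C 0 by rewrite FC0 subr0.
  case: (leP 0 t) => t0;
    first by apply: (eq_derive_eq (df := f) t0) => s ?; [apply: FB|apply: FC]; lra.
  suff : F B 0 - F B t = F C 0 - F C t by lra.
  by apply: (@eq_derive_eq _ _ f t 0); [exact: ltW | |] => s ?; [apply: FB|apply: FC]; lra.
(* Primitives vanishing at 0 agree on common domains, so the radius may vary with [t]; near a given
   [t] the fixed radius [|t| + 2] gives the same function. *)
exists (fun t => F (`|t| + 1) t) => [|t]; first exact: (FP _).1.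
apply: (@near_eq_is_derive _ _ _ (F (`|t| + 2))).
  near=> s; apply: agree.
    have : `|t - s| < 1 by near: s; exact: cvgr_dist_lt.
    by have := ler_normD (s - t) t; rewrite subrK distrC; lra.
  by rewrite ltrDl.
by apply: (FP (`|t| + 2)).2; rewrite -ltr_norml ltrDl.
Unshelve. all: by end_near. Qed.

Lemma row_primitive n (f : R -> 'rV[R]_n) : continuous f ->
  exists2 F : R -> 'rV[R]_n, F 0 = 0 & forall t, is_derive t (1 : R) F (f t).
Proof.
move=> cf; have /choice[F FP] : forall i, exists F : R -> R, F 0 = 0 /\
    forall t, is_derive t (1 : R) F (f t 0 i).
  move=> i; have [|F F0 Fd] := @scalar_primitive (fun t => f t 0 i); last by exists F.
  move=> t; apply: (@continuous_comp _ _ _ f (fun v => v 0 i)); first exact: cf.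
  exact: coord_continuous.
exists (fun t => \row_i F i t) => [|t].
  by apply/rowP => i; rewrite !mxE (FP i).1.
apply: is_derive_row => i; rewrite (_ : (fun s => _) = F i); last first.
  by apply/funext => s; rewrite mxE.
exact: (FP i).2.
Qed.

End Primitive.

Section Picard.
Variable R : realType.

Lemma le0_geometric (x C : R) : (forall k, x <= C / 2 ^+ k) -> x <= 0.
Proof.
move=> xC; apply/ler_addgt0Pl => e e0; rewrite addr0.
have C1 : 0 < `|C| + 1 by rewrite ltr_pwDr.
near \oo => k; apply: le_trans (xC k) _.
have : 1 / 2 ^+ k < (e / (`|C| + 1)).
  by near: k; exact: (near_infty_natSinv_expn_lt (PosNum (divr_gt0 e0 C1))).
rewrite div1r ltr_pdivlMr// => /ltW; apply: le_trans.
by rewrite mulrC ler_wpM2l ?invr_ge0 ?exprn_ge0//; have := ler_norm C; lra.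
Unshelve. all: by end_near. Qed.

Lemma is_derive_expRM (c t : R) :
  is_derive t (1 : R) (fun s => expR (c * s)) (c * expR (c * t)).
Proof.
have h : is_derive t (1 : R) ( *%R c) c.
  by apply: (is_derive_eq (is_deriveZ c (is_derive_id t (1 : R)))); rewrite /GRing.scale/= mulr1.
by apply: (is_derive_eq (is_derive1_comp (is_derive_expR _) h)); rewrite mulrC.
Qed.

(** Integrating the weight [expR (c * |t|)] from 0 divides it by [c]; this is the gain exploited by
    the Picard iteration. *)
Lemma exp_growth_bound n (w dw : R -> 'rV[R]_n) (K c : R) : 0 <= K ->
  w 0 = 0 -> (forall t, is_derive t (1 : R) w (dw t)) ->
  (forall t, `|dw t| <= c * K * expR (c * `|t|)) ->
  forall t, `|w t| <= K * expR (c * `|t|).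
Proof.
move=> K0 w0 wd dwle t; case: (leP 0 t) => t0.
  rewrite ger0_norm//.
  have gd s : is_derive s (1 : R) (K *: (fun s => expR (c * s))) (c * K * expR (c * s)).
    by apply: (is_derive_eq (is_deriveZ K (is_derive_expRM c s)));
      rewrite /GRing.scale/= mulrCA mulrA.
  have := norm_derive_le_sub t0 (fun s _ => wd s) (fun s _ => gd s).
  rewrite w0 subr0 /= !fctE /GRing.scale/= mulr0 expR0 mulr1 => H.
  apply: le_trans (H _) _; last by rewrite gerBl.
  by move=> s /andP[s0 _]; rewrite (le_trans (dwle s))// ger0_norm// ltW.
rewrite ltr0_norm//.
have gd s : is_derive s (1 : R) ((- K) *: (fun s => expR (- c * s))) (c * K * expR (- c * s)).
  by apply: (is_derive_eq (is_deriveZ (- K) (is_derive_expRM (- c) s)));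
    rewrite /GRing.scale/=; ring.
have := norm_derive_le_sub (ltW t0) (fun s _ => wd s) (fun s _ => gd s).
rewrite w0 sub0r normrN /= !fctE /GRing.scale/= mulr0 expR0 mulr1 => H.
rewrite mulrN -mulNr; apply: le_trans (H _) _; last by lra.
move=> s /andP[_ s0]; rewrite (le_trans (dwle s))// ltr0_norm//.
by rewrite mulNr mulrN.
Qed.

Lemma norm_lipschitz_continuous (V W : normedModType R) (f : V -> W) (C : R) :
  0 <= C -> (forall u v, `|f u - f v| <= C * `|u - v|) -> continuous f.
Proof.
move=> C0 fC u; apply/cvgrPdist_lt => e e0.
have C1 : 0 < C + 1 by lra.
near=> v; rewrite (le_lt_trans (fC _ _))//.
apply: (@le_lt_trans _ _ ((C + 1) * `|u - v|)).
  by rewrite ler_wpM2r//; lra.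
rewrite mulrC -ltr_pdivlMr//; near: v.
by apply: cvgr_dist_lt; rewrite ?divr_gt0.
Unshelve. all: by end_near. Qed.

(** Measuring iterates against an exponential weight (Bielecki's norm) replaces the usual short time
    interval, so the solution is global without gluing. The rate [c = 2 * L + 2] gives [L <= c / 2]
    for the contraction and [1 <= c] for the first iterate. *)
Theorem picard n (Psi : 'rV[R]_n -> 'rV[R]_n) (L M : R) (p : 'rV[R]_n) :
  0 <= L -> 0 <= M ->
  (forall u v, `|Psi u - Psi v| <= L * `|u - v|) -> (forall u, `|Psi u| <= M) ->
  exists2 y : R -> 'rV[R]_n, y 0 = p &
    forall t, is_derive t (1 : R) y (Psi (y t)).
Proof.
move=> L0 M0 PsiL PsiM.
have cPsi : continuous Psi := norm_lipschitz_continuous L0 PsiL.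
have cPsif (f : R -> 'rV[R]_n) : continuous f -> continuous (Psi \o f).
  by move=> cf t; apply: continuous_comp; [exact: cf|exact: cPsi].
have /choice[step stepP] : forall f : R -> 'rV[R]_n, exists F : R -> 'rV[R]_n,
    continuous f -> F 0 = p /\ forall t, is_derive t (1 : R) F (Psi (f t)).
  move=> f; have [cf|ncf] := pselect (continuous f); last by exists 0.
  have [F F0 Fd] := row_primitive (cPsif f cf); exists (cst p + F) => _.
  split=> [|t]; first by rewrite !fctE F0 addr0.
  by apply: (is_derive_eq (is_deriveD (is_derive_cst p t (1 : R)) (Fd t))); rewrite add0r.
have [u uE0 uES] : exists2 u : nat -> R -> 'rV[R]_n,
    u 0%N = cst p & forall k, u k.+1 = step (u k).
  by exists (fun k => iter k step (cst p)).
have cu k : continuous (u k).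
  elim: k => [|k IH] t; first by rewrite uE0; exact: cvg_cst.
  by rewrite uES; exact: is_derive_continuous ((stepP _ IH).2 t).
have ud0 t : is_derive t (1 : R) (u 0%N) 0 by rewrite uE0; exact: is_derive_cst.
have ud k t : is_derive t (1 : R) (u k.+1) (Psi (u k t)).
  by rewrite uES; exact: (stepP _ (cu k)).2.
have u0 k : u k 0 = p.
  by case: k => [|k]; [rewrite uE0|rewrite uES; exact: (stepP _ (cu k)).1].
(* The weight [E] makes the Picard operator contract by 1/2 on all of R. *)
pose c := 2 * L + 2; pose E (t : R) := expR (c * `|t|).
have E0 t : 0 <= E t by exact: expR_ge0.
have E1 t : 1 <= E t by rewrite -expR0 ler_expR mulr_ge0// /c; lra.
have uS k t : `|u k.+1 t - u k t| <= M / 2 ^+ k * E t.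
  elim: k t => [|k IH] t.
    rewrite expr0 divr1.
    apply: (@exp_growth_bound n (fun t => u 1%N t - u 0%N t) (fun t => Psi (u 0%N t) - 0)).
    - exact: M0.
    - by rewrite !u0 subrr.
    - move=> s; rewrite subr0 (le_trans (PsiM _))// -/(E s) -[leLHS]mulr1 ler_pM//.
      by rewrite ler_peMl// /c; lra.
  apply: (@exp_growth_bound n (fun t => u k.+2 t - u k.+1 t)
    (fun t => Psi (u k.+1 t) - Psi (u k t))).
  - by rewrite divr_ge0 ?exprn_ge0.
  - by rewrite !u0 subrr.
  - move=> s; rewrite (le_trans (PsiL _ _))// (le_trans (ler_wpM2l L0 (IH s)))//.
    rewrite -/(E s) /c exprS invfM.
    set a := (2 ^+ k)^-1; have a0 : 0 <= a by rewrite invr_ge0 exprn_ge0.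
    have : 0 <= M * a * E s by rewrite !mulr_ge0.
    lra.
(* The right-hand side is the exact geometric sum of the increments, which makes the induction on
   [j] close. *)
have uD k j t : `|u (k + j)%N t - u k t| <= 2 * M * E t / 2 ^+ k - 2 * M * E t / 2 ^+ (k + j).
  elim: j => [|j IH]; first by rewrite addn0 !subrr normr0.
  rewrite addnS -(subrKA (u (k + j)%N t)) (le_trans (ler_normD _ _))//.
  have := uS (k + j)%N t; rewrite [in X in _ -> _ <= X]exprS.
  move: IH; have : (2 : R) ^+ (k + j) != 0 by rewrite expf_neq0.
  move: (2 ^+ (k + j)) (2 ^+ k)^-1 => b a b0 IH uSj; rewrite addrC.
  rewrite (_ : _ - _ = (2 * M * E t * a - 2 * M * E t / b) + M / b * E t); last by field.
  exact: lerD.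
have uB k j t : `|u (k + j)%N t - u k t| <= 2 * M * E t / 2 ^+ k.
  rewrite (le_trans (uD k j t))// gerBl.
  by rewrite divr_ge0 ?exprn_ge0// !mulr_ge0.
have small C (e : R) : 0 < e -> exists k, C / 2 ^+ k < e.
  move=> e0; apply/not_existsP => H; suff : e <= 0 by lra.
  by apply: (@le0_geometric _ C) => k; rewrite leNgt; apply/negP; exact: H.
have ucvg t : cvg (u k t @[k --> \oo]).
  apply: cauchy_cvg; apply: cauchy_exP => e e0.
  have [k ke] := small (2 * M * E t) e e0.
  exists (u k t); exists k => // j /= kj.
  rewrite -ball_normE/= distrC -(subnKC kj).
  exact: le_lt_trans (uB _ _ _) ke.
pose y (t : R) := lim (u k t @[k --> \oo]).
have yu k t : `|y t - u k t| <= 2 * M * E t / 2 ^+ k.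
  apply/ler_addgt0Pl => e e0.
  have := ucvg t; move/cvgrPdist_lt => /(_ e e0)[N _ /(_ (k + N)%N)/= H].
  rewrite -(subrKA (u (k + N)%N t)) (le_trans (ler_normD _ _))// lerD//.
  by rewrite ltW// H// leq_addl.
(* The iterates share the Lipschitz constant [M]; it passes to the limit, whose continuity is
   required before [step] applies to it. *)
have uLip k s t : `|u k s - u k t| <= M * `|s - t|.
  wlog st : s t / t <= s => [H|].
    case: (leP t s) => [/H//|/ltW/H]; by rewrite distrC (distrC t).
  rewrite ger0_norm ?subr_ge0//; case: k => [|k].
    by rewrite uE0 subrr normr0 mulr_ge0 ?subr_ge0.
  exact: (norm_derive_le st (fun r _ => ud k r) (fun r _ => PsiM _)).
have cy : continuous y.
  apply: (norm_lipschitz_continuous M0) => s t; rewrite -subr_le0.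
  apply: (@le0_geometric _ (2 * M * E s + 2 * M * E t)) => k.
  have := yu k s; have := yu k t; have := uLip k s t.
  have := ler_normD (y s - u k s) (u k s - u k t + (u k t - y t)).
  have := ler_normD (u k s - u k t) (u k t - y t).
  rewrite subrKA subrKA (distrC (u k t)) mulrDl; lra.
have [v0 vd] := stepP _ cy.
(* Differentiability comes from [step y] being a primitive, so no limit of derivatives is taken;
   [step y] and [y] are both geometrically close to [u k.+1]. *)
suff vy : step y = y by exists (step y) => // t; rewrite [in X in is_derive _ _ _ X]vy.
apply/funext => t; apply/subr0_eq/normr0_eq0/eqP; rewrite eq_le normr_ge0 andbT.
apply: (@le0_geometric _ (4 * M * E t)) => k.
have : `|(step y - u k.+1) t| <= 2 * M / 2 ^+ k * E t.
  apply: (@exp_growth_bound n (step y - u k.+1) (fun t => Psi (y t) - Psi (u k t))).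
  - by rewrite divr_ge0 ?mulr_ge0 ?exprn_ge0.
  - by rewrite !fctE v0 u0 subrr.
  - move=> s; rewrite (le_trans (PsiL _ _))// (le_trans (ler_wpM2l L0 (yu k s)))//.
    rewrite -/(E s) /c; set a := (2 ^+ k)^-1; have a0 : 0 <= a by rewrite invr_ge0 exprn_ge0.
    have : 0 <= M * a * E s by rewrite !mulr_ge0.
    have : 0 <= L * (M * a * E s) by rewrite !mulr_ge0.
    lra.
have := yu k.+1 t; rewrite distrC exprS invfM.
have := ler_normD (step y t - u k.+1 t) (u k.+1 t - y t); rewrite subrKA !fctE.
set a := (2 ^+ k)^-1; have a0 : 0 <= a by rewrite invr_ge0 exprn_ge0.
have : 0 <= M * a * E t by rewrite !mulr_ge0.
lra.
Unshelve. all: by end_near. Qed.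

End Picard.

(** * Smooth vector fields *)

Section SmoothField.
Variable R : realType.

Lemma compact_continuous_bounded (U : topologicalType) (V : normedModType R)
    (f : U -> V) (A : set U) : compact A -> continuous f ->
  exists2 M, 0 <= M & forall x, A x -> `|f x| <= M.
Proof.
move=> cA cf.
have /compact_bounded[M0 [_ fM]] := continuous_compact (continuous_subspaceT cf) cA.
exists (`|M0| + 1) => [|x Ax]; first by rewrite addr_ge0.
by apply: fM; [have := ler_norm M0; lra | exists x].
Qed.

Lemma compact_norm_le n (N : R) : compact [set v : 'rV[R]_n | `|v| <= N].
Proof.
apply: bounded_closed_compact.
  by exists N; split; [exact: num_real|move=> x Nx v /= /le_trans; apply; exact: ltW].
have -> : [set v : 'rV[R]_n | `|v| <= N] =
  (fun v : 'rV[R]_n => `|v|) @^-1` [set x | x <= N] by [].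
by apply: preimage_closed; [move=> v _; exact: norm_continuous | exact: closed_le].
Qed.

Lemma mulmx_norm_le n (v : 'rV[R]_n) (B : 'M[R]_n) :
  `|v *m B| <= n%:R * `|v| * `|B|.
Proof.
apply: row_norm_le => [|j]; first by rewrite !mulr_ge0.
rewrite mxE (le_trans (ler_norm_sum _ _ _))//.
rewrite (le_trans (ler_sum _ (G := fun=> `|v| * `|B|) _))//.
  move=> k _; rewrite normrM ler_pM ?coord_norm_le//.
  rewrite [leRHS]/Num.Def.normr/= mx_normrE.
  exact: (le_bigmax _ _ (k, j)).
by rewrite sumr_const card_ord -mulrA [leRHS]mulr_natl.
Qed.

Definition clampr (N x : R) : R := Num.max (- N) (Num.min x N).

Lemma clampr_norm_le N x : 0 <= N -> `|clampr N x| <= N.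
Proof.
move=> N0; rewrite /clampr ler_norml.
by have [?|?] := leP x N;
  match goal with |- context [Order.max ?u ?v] => have [?|?] := leP u v end; lra.
Qed.

Lemma clampr_id N x : `|x| <= N -> clampr N x = x.
Proof.
rewrite /clampr ler_norml => /andP[? ?].
by have [?|?] := leP x N;
  match goal with |- context [Order.max ?u ?v] => have [?|?] := leP u v end; lra.
Qed.

Lemma clampr_lipschitz N x y : 0 <= N -> `|clampr N x - clampr N y| <= `|x - y|.
Proof.
move=> N0.
have H a b : a <= b -> clampr N a <= clampr N b <= clampr N a + (b - a).
  move=> ab; rewrite /clampr; have [?|?] := leP a N; have [?|?] := leP b N;
  repeat match goal with |- context [Order.max ?u ?v] => have [?|?] := leP u v end; lra.
case: (leP x y) => [xy|/ltW xy].
  by rewrite !ler0_norm; have := H _ _ xy; lra.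
by rewrite !ger0_norm; have := H _ _ xy; lra.
Qed.

(** The ball of the sup norm is a cube, so clamping coordinates retracts onto it without increasing
    distances. *)
Definition clamp n (N : R) (v : 'rV[R]_n) : 'rV[R]_n := \row_i clampr N (v 0 i).

Lemma clamp_norm_le n N (v : 'rV[R]_n) : 0 <= N -> `|clamp N v| <= N.
Proof. by move=> N0; apply: row_norm_le => // i; rewrite mxE clampr_norm_le. Qed.

Lemma clamp_id n N (v : 'rV[R]_n) : `|v| <= N -> clamp N v = v.
Proof.
move=> vN; apply/rowP => i; rewrite mxE clampr_id//.
exact: le_trans (coord_norm_le _ _) vN.
Qed.

Lemma clamp_lipschitz n N (u v : 'rV[R]_n) : 0 <= N ->
  `|clamp N u - clamp N v| <= `|u - v|.
Proof.
move=> N0; apply: row_norm_le => // i; rewrite !mxE.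
rewrite (le_trans (clampr_lipschitz _ _ N0))//.
by have := coord_norm_le (u - v) i; rewrite !mxE.
Qed.

(** Mean value inequality on the segment for [psi] minus a linear map: [A = 0] yields the Lipschitz
    bound, [A = jacobian psi u] the Taylor bound. *)
Lemma segment_jacobian_le n (psi : 'rV[R]_n -> 'rV[R]_n) (u d : 'rV[R]_n)
    (A : 'M[R]_n) (c : R) : (forall p, differentiable psi p) ->
  (forall s, 0 <= s <= 1 -> `|d *m (jacobian psi (s *: d + u) - A)| <= c) ->
  `|psi (d + u) - psi u - d *m A| <= c.
Proof.
move=> psid Jc.
pose f (s : R) := psi (s *: d + u) - s *: (d *m A).
have fd s : is_derive s (1 : R) f (d *m jacobian psi (s *: d + u) - d *m A).
  have h1 : is_derive s (1 : R) (fun s => psi (s *: d + u)) (d *m jacobian psi (s *: d + u)).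
    rewrite -deriveEjacobian//.
    have psd : derivable psi (s *: d + u) d by exact: diff_derivable.
    pose F (r : R) := psi (r *: d + u).
    have E : (fun h : R => h^-1 *: ((F \o shift s) (h *: (1 : R)) - F s)) =
        (fun h : R => h^-1 *: ((psi \o shift (s *: d + u)) (h *: d) - psi (s *: d + u))).
      by apply/funext => r; rewrite /F/= scalerDl /GRing.scale/= mulr1 addrA.
    by split; [rewrite /derivable E|rewrite /derive E].
  exact: (is_deriveB h1 (is_derive_scale (d *m A) s)).
have := norm_derive_le (f := f) (K := c) ler01 (fun s _ => fd s).
rewrite /f !scale0r !scale1r add0r !subr0 mulr1.
rewrite (addrAC (psi _)); apply => s /andP[s0 s1].
by rewrite -mulmxBr Jc// !ltW.
Qed.

Variable psi : 'rV[R]_2 -> 'rV[R]_2.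
Hypothesis psiC1 : C1 psi.

Lemma C1_lipschitz_box (N : R) : exists2 L, 0 <= L &
  forall u v, `|u| <= N -> `|v| <= N -> `|psi u - psi v| <= L * `|u - v|.
Proof.
have [M M0 JM] := compact_continuous_bounded (compact_norm_le (n := 2) (N := N)) psiC1.2.
exists (2 * M) => [|u v uN vN]; first by rewrite mulr_ge0.
have := @segment_jacobian_le 2 psi v (u - v) 0 (2 * M * `|u - v|) psiC1.1.
rewrite mulmx0 subr0 subrK; apply => s /andP[s0 s1]; rewrite subr0.
rewrite (le_trans (mulmx_norm_le _ _))// mulrAC ler_wpM2r// ler_wpM2l//.
apply: JM => /=; rewrite (_ : _ + v = s *: u + (1 - s) *: v); last first.
  by rewrite scalerBr scalerBl scale1r addrA addrAC.
rewrite (le_trans (ler_normD _ _))// !normrZ !ger0_norm ?subr_ge0//.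
have := ler_wpM2l s0 uN; have := @ler_wpM2l _ (1 - s) _ _ _ vN; rewrite subr_ge0.
by move=> /(_ s1); lra.
Qed.

(** Uniform continuity of the jacobian around the ball makes [d] independent of [u]. The [e / 2]
    offsets the dimension factor 2 of [mulmx_norm_le]. *)
Lemma C1_taylor_unif (N e : R) : 0 < e -> exists2 d, 0 < d &
  forall u v, `|u| <= N -> `|v - u| <= d ->
    `|psi v - psi u - (v - u) *m jacobian psi u| <= e * `|v - u|.
Proof.
move=> e0; have e20 : 0 < e / 2 by rewrite divr_gt0.
have [d d0 Jd] := compact_unif_continuous (compact_norm_le (n := 2) (N := N)) psiC1.2 e20.
exists (d / 2) => [|u v uN uv]; first by rewrite divr_gt0.
have := @segment_jacobian_le 2 psi u (v - u) (jacobian psi u) (e * `|v - u|) psiC1.1.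
rewrite subrK; apply => s /andP[s0 s1].
rewrite (le_trans (mulmx_norm_le _ _))// mulrAC ler_wpM2r//.
rewrite mulrC -ler_pdivlMr// ltW//.
rewrite distrC; apply: Jd => //.
rewrite distrC addrK normrZ ger0_norm//.
have := ler_wpM2r (normr_ge0 (v - u)) s1; rewrite mul1r; lra.
Qed.

End SmoothField.

(** * The adjoint system along a closed orbit *)

Section Cycle.
Variable R : realType.

Lemma periodic_reduce (V : Type) (f : R -> V) (T t : R) : 0 < T ->
  (forall u, f (u + T) = f u) -> exists2 s, 0 <= s <= T & f t = f s.
Proof.
move=> T0 fT; have fn n u : f (u + T *+ n) = f u.
  elim: n => [|n IH]; first by rewrite addr0.
  by rewrite mulrSr addrA fT IH.
have fz (k : int) u : f (u + T * k%:~R) = f u.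
  case: k => n; first by rewrite -pmulrn mulr_natr fn.
  by rewrite NegzE mulrNz mulrN -pmulrn mulr_natr -[in RHS](subrK (T *+ n.+1) u) fn.
exists (t + T * (- Num.floor (t / T))%:~R); last by rewrite fz.
have := Num.Theory.floor_itv (t / T).
rewrite intrD mulrNz mulrN ltr_pdivrMr// ler_pdivlMr// => /andP[? ?].
by apply/andP; split; lra.
Qed.

Variables (psi : 'rV[R]_2 -> 'rV[R]_2) (T : R) (x0 : R -> 'rV[R]_2).
Hypotheses (psiC1 : C1 psi) (x0_orbit : closed_orbit_of_period psi T x0).

Let x0_sol : solution psi x0. Proof. by case: x0_orbit. Qed.
Let T_gt0 : 0 < T. Proof. by case: x0_orbit. Qed.
Let x0T : forall t, x0 (t + T) = x0 t. Proof. by case: x0_orbit. Qed.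

Lemma orbit_bounded : exists2 N, 0 <= N & forall t, `|x0 t| <= N.
Proof.
have cx0 : continuous x0 by move=> t; exact: is_derive_continuous (x0_sol t).
have [N N0 xN] := compact_continuous_bounded (segment_compact (a := 0) (b := T)) cx0.
exists N => // t; have [s s0T ->] := periodic_reduce t T_gt0 x0T.
by apply: xN; rewrite /= in_itv.
Qed.

(** An equilibrium on the orbit would make [x0] constant by Gronwall, and then [T / 2] would be a
    period. *)
Lemma orbit_field_neq0 t : psi (x0 t) != 0.
Proof.
apply/eqP => psi0; case: x0_orbit => _ _ _ /(_ (T / 2)) H.
have [N N0 xN] := orbit_bounded.
have [L L0 psiL] := C1_lipschitz_box psiC1 N.
apply: H; first by have := T_gt0; lra.
suff xt s : x0 s = x0 t by move=> s; rewrite !xt.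
have wd r : is_derive r (1 : R) (fun r => x0 r - x0 t) (psi (x0 r) - psi (x0 t)).
  rewrite [psi (x0 t)]psi0.
  exact: (is_deriveB (x0_sol r) (is_derive_cst (x0 t) r (1 : R))).
have wle r : `|psi (x0 r) - psi (x0 t)| <= L * `|x0 r - x0 t| + 0.
  by rewrite addr0 psiL.
have := gronwall_both L0 (lexx 0) wd wle t s.
by rewrite subrr normr0 addr0 mulr0 normr_le0 subr_eq0 => /eqP.
Qed.

Lemma is_derive_orbit_field t :
  is_derive t (1 : R) (psi \o x0) (psi (x0 t) *m jacobian psi (x0 t)).
Proof.
have [xd xE] := x0_sol t.
have xdiff : differentiable x0 t by exact/derivable1_diffP.
have pdiff := psiC1.1 (x0 t).
have cdiff : differentiable (psi \o x0) t by exact: differentiable_comp.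
apply: DeriveDef; first exact/derivable1_diffP.
have dx : 'd x0 t (1 : R) = psi (x0 t) by rewrite -deriveE.
by rewrite deriveE// diff_comp//= dx -deriveE// deriveEjacobian.
Qed.

Section Adjoint.
Variable z : R -> 'rV[R]_2.
Hypothesis z_sol : linear_solution (adjoint psi x0) z.

(** Pairing with an adjoint solution cancels the linear part: only the defect of [w] as a solution
    of the linearized system remains. Both main estimates rest on this. *)
Lemma is_derive_adjoint_dot w dw t : is_derive t (1 : R) w dw ->
  is_derive t (1 : R) (fun s => dot (z s) (w s))
    (dot (z t) (dw - w t *m jacobian psi (x0 t))).
Proof.
move=> wd; apply: (is_derive_eq (is_derive_dot (z_sol t) wd)).
by rewrite /adjoint mulmxN dotNl dot_mulmx_tr dotBr addrC.
Qed.

Lemma adjoint_dot_field s t : dot (z s) (psi (x0 s)) = dot (z t) (psi (x0 t)).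
Proof.
apply: (@is_derive_0_is_cst R (fun s => dot (z s) (psi (x0 s)))) => r.
apply: (is_derive_eq (is_derive_adjoint_dot (is_derive_orbit_field r))).
by rewrite subrr dotE !mxE !mulr0 addr0.
Qed.

Lemma adjoint_eq0 t : z t = 0 -> forall s, z s = 0.
Proof.
move=> zt s; have [N N0 xN] := orbit_bounded.
have [M M0 JM] := compact_continuous_bounded (compact_norm_le (n := 2) (N := N)) psiC1.2.
have M20 : 0 <= 2 * M by rewrite mulr_ge0.
have zle r : `|z r *m adjoint psi x0 r| <= 2 * M * `|z r| + 0.
  rewrite addr0 (le_trans (mulmx_norm_le _ _))// mulrAC ler_wpM2r// ler_wpM2l//.
  rewrite /adjoint normrN; apply: le_trans (JM _ (xN r)).
  rewrite [leLHS]/Num.Def.normr/= mx_normrE bigmax_le// => -[i j] _ /=.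
  rewrite mxE [leRHS]/Num.Def.normr/= mx_normrE.
  exact: (le_bigmax _ _ (j, i)).
have := gronwall_both M20 (lexx 0) z_sol zle t s.
by rewrite zt normr0 addr0 mulr0 normr_le0 => /eqP.
Qed.

End Adjoint.

Variables (z0 z1 : R -> 'rV[R]_2) (rho : R).
Hypotheses (rho_neq1 : rho != 1)
  (z0_eigen : eigenfunction (adjoint psi x0) T 1 z0)
  (z1_eigen : eigenfunction (adjoint psi x0) T rho z1).

Lemma eigenfunction_neq0 mu z : eigenfunction (adjoint psi x0) T mu z ->
  forall t, z t != 0.
Proof.
move=> [z_sol [t zt] _] s; apply: contra zt => /eqP zs.
by rewrite (adjoint_eq0 z_sol zs).
Qed.

Definition cross (u v : 'rV[R]_2) : R := u 0 0 * v 0 1 - u 0 1 * v 0 0.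

(** If [z0] and [z1] were parallel at one time, the adjoint solution [z1 - c z0] would vanish there,
    hence everywhere, and both would have the same multiplier. The coefficient [c] is that of the
    orthogonal projection. *)
Lemma cross_eigen_neq0 t : cross (z0 t) (z1 t) != 0.
Proof.
have [z0_sol _ z0T] := z0_eigen; have [z1_sol _ z1T] := z1_eigen.
apply/eqP => crs; pose c := dot (z0 t) (z1 t) / dot (z0 t) (z0 t).
have n0 : dot (z0 t) (z0 t) != 0.
  apply: contra (eigenfunction_neq0 z0_eigen t) => /eqP d0.
  have := norm_le_dot (z0 t).
  by rewrite d0 -normr_le0 exprn_even_le0//= normr_eq0 => /eqP->; rewrite normr0.
have z1c : z1 t - c *: z0 t = 0.
  have e0 : dot (z0 t) (z0 t) * (z1 t 0 0 - c * z0 t 0 0) = 0.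
    rewrite mulrBr mulrA [_ * c]mulrC /c divfK// !dotE.
    by transitivity (- z0 t 0 1 * cross (z0 t) (z1 t)); [rewrite /cross; ring|rewrite crs mulr0].
  have e1 : dot (z0 t) (z0 t) * (z1 t 0 1 - c * z0 t 0 1) = 0.
    rewrite mulrBr mulrA [_ * c]mulrC /c divfK// !dotE.
    by transitivity (z0 t 0 0 * cross (z0 t) (z1 t)); [rewrite /cross; ring|rewrite crs mulr0].
  apply/eqP; rewrite -normr_le0; apply: row_norm_le => // i; rewrite !mxE.
  have [-> | ->] : i = 0 \/ i = 1.
    by case: i => -[|[|//]] ?; [left|right]; exact: val_inj.
    by move/eqP: e0; rewrite mulf_eq0 (negbTE n0)/= => /eqP->; rewrite normr0.
  by move/eqP: e1; rewrite mulf_eq0 (negbTE n0)/= => /eqP->; rewrite normr0.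
have v_sol : linear_solution (adjoint psi x0) (fun s => z1 s - c *: z0 s).
  move=> s; apply: (is_derive_eq (is_deriveB (z1_sol s) (is_deriveZ c (z0_sol s)))).
  by rewrite mulmxBl scalemxAl.
have z1E s : z1 s = c *: z0 s.
  by apply/subr0_eq; exact: (adjoint_eq0 v_sol z1c s).
have := z1T t; rewrite !z1E z0T scale1r scalerA => /eqP.
rewrite -subr_eq0 -scalerBl scaler_eq0 (negbTE (eigenfunction_neq0 z0_eigen t)) orbF.
rewrite -[X in X - _]mul1r -mulrBl mulf_eq0 subr_eq0 eq_sym (negbTE rho_neq1)/= => /eqP c0.
by have := eigenfunction_neq0 z1_eigen t; rewrite z1E c0 scale0r eqxx.
Qed.

(** The pairing is constant in time, yet a period multiplies it by [rho], which is not 1. *)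
Lemma eigen_dot_field1 t : dot (z1 t) (psi (x0 t)) = 0.
Proof.
have [z1_sol _ z1T] := z1_eigen.
have := adjoint_dot_field z1_sol (t + T) t.
rewrite x0T z1T dotZl => /eqP; rewrite -subr_eq0 -[X in _ - X]mul1r -mulrBl mulf_eq0.
by rewrite subr_eq0 (negbTE rho_neq1) => /eqP.
Qed.

(** Cramer's rule for recovering [w] from its two pairings, with the determinant kept on the
    left. *)
Lemma cross_solve (u v w : 'rV[R]_2) :
  `|w| * `|cross u v| <= (`|dot u w| + `|dot v w|) * (`|u| + `|v|).
Proof.
rewrite mulrC -normrZ; apply: row_norm_le => [|i].
  by rewrite mulr_ge0// addr_ge0.
have bnd (a b p q : R) : `|p| <= `|v| -> `|q| <= `|u| ->
    `|a * p - b * q| <= (`|a| + `|b|) * (`|u| + `|v|).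
  move=> pv qu; rewrite (le_trans (ler_normB _ _))// !normrM.
  have := ler_wpM2l (normr_ge0 a) pv; have := ler_wpM2l (normr_ge0 b) qu.
  have := mulr_ge0 (normr_ge0 a) (normr_ge0 u).
  by have := mulr_ge0 (normr_ge0 b) (normr_ge0 v); lra.
have -> : (cross u v *: w) 0 i =
    dot u w * (if i == 0 then v 0 1 else - v 0 0) -
    dot v w * (if i == 0 then u 0 1 else - u 0 0).
  rewrite mxE /cross !dotE; case: i => -[|[|//]] /= ilt.
    by rewrite (_ : Ordinal ilt = 0) ?eqxx; [ring | exact: val_inj].
  by rewrite (_ : Ordinal ilt = 1)/=; [ring | exact: val_inj].
by apply: bnd; case: ifP => _; rewrite ?normrN coord_norm_le.
Qed.

(** The nonzero vector [psi (x0 t)] is orthogonal to [z1 t], so it cannot be orthogonal to the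
    independent [z0 t] as well. *)
Lemma eigen_dot_field0 : exists2 c, c != 0 &
  forall t, dot (z0 t) (psi (x0 t)) = c.
Proof.
have [z0_sol _ _] := z0_eigen.
exists (dot (z0 0) (psi (x0 0))) => [|t]; last exact: adjoint_dot_field.
apply/negP => /eqP d0; have := cross_solve (z0 0) (z1 0) (psi (x0 0)).
rewrite d0 eigen_dot_field1 normr0 addr0 mul0r.
by rewrite leNgt mulr_gt0 ?normr_gt0 ?cross_eigen_neq0 ?orbit_field_neq0.
Qed.

(** The bound covers [[-T, T]] because the estimates run over [[t - T, t]] with [t] in [[0, T]];
    [z1] may be unbounded on the whole line. *)
Lemma eigen_bounded : exists2 Z, 0 <= Z &
  forall t, `|t| <= T -> `|z0 t| <= Z /\ `|z1 t| <= Z.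
Proof.
have [z0_sol _ _] := z0_eigen; have [z1_sol _ _] := z1_eigen.
have cz0 : continuous z0 by move=> t; exact: is_derive_continuous (z0_sol t).
have cz1 : continuous z1 by move=> t; exact: is_derive_continuous (z1_sol t).
have [M M0 zM] := compact_continuous_bounded (segment_compact (a := - T) (b := T)) cz0.
have [N N0 zN] := compact_continuous_bounded (segment_compact (a := - T) (b := T)) cz1.
exists (M + N) => [|t]; first exact: addr_ge0.
rewrite ler_norml => tT; have zt : `[- T, T]%classic t by rewrite /= in_itv.
by have := zM t zt; have := zN t zt; split; lra.
Qed.

Lemma eigen_solve : exists2 C, 0 < C & forall t w, 0 <= t <= T ->
  `|w| <= C * (`|dot (z0 t) w| + `|dot (z1 t) w|).
Proof.
have [z0_sol _ _] := z0_eigen; have [z1_sol _ _] := z1_eigen.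
have cc : continuous (fun t => `|cross (z0 t) (z1 t)|).
  have cz0 i t : {for t, continuous (fun s => z0 s 0 i)}.
    exact: is_derive_continuous (is_derive_coord i (z0_sol t)).
  have cz1 i t : {for t, continuous (fun s => z1 s 0 i)}.
    exact: is_derive_continuous (is_derive_coord i (z1_sol t)).
  move=> t; apply: (continuous_comp (f := fun s => cross (z0 s) (z1 s)));
    last exact: norm_continuous.
  apply: (@continuousB _ _ _ (fun s => z0 s 0 0 * z1 s 0 1)
    (fun s => z0 s 0 1 * z1 s 0 0)).
    exact: (continuousM (cz0 _ _) (cz1 _ _)).
  exact: (continuousM (cz0 _ _) (cz1 _ _)).
have [m _ mP] := EVT_min (ltW T_gt0) (continuous_subspaceT cc).
set d := `|_| in mP; have d0 : 0 < d by rewrite normr_gt0 cross_eigen_neq0.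
have [Z Z0 zZ] := eigen_bounded.
(* [d] is the least determinant over a period; the added 1 keeps the constant positive even when
   [Z = 0]. *)
exists ((2 * Z + 1) / d) => [|t w tT]; first by rewrite divr_gt0//; lra.
rewrite mulrAC ler_pdivlMr//.
have /mP dt : t \in `[0, T] by rewrite in_itv.
have [z0Z z1Z] : `|z0 t| <= Z /\ `|z1 t| <= Z.
  by apply: zZ; rewrite ger0_norm; lra.
apply: (@le_trans _ _ (`|w| * `|cross (z0 t) (z1 t)|)); first by rewrite ler_wpM2l.
rewrite (le_trans (cross_solve _ _ _))// mulrC ler_wpM2r ?addr_ge0//; lra.
Qed.

End Cycle.

(** * The perturbation *)

Section Perturbation.
Variables (R : realType) (phi : R -> 'rV[R]_2 -> R -> 'rV[R]_2).
Hypothesis phiC : {within [set p : R * 'rV[R]_2 * R | 0 <= p.2 <= 1],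
  continuous (fun p : R * 'rV[R]_2 * R => phi p.1.1 p.1.2 p.2)}.

(* [`|clampr 1 e|] retracts R onto [0, 1], where [phi] is known to be continuous. *)
Definition retract (N : R) (p : R * 'rV[R]_2 * R) : R * 'rV[R]_2 * R :=
  (p.1.1, clamp N p.1.2, `|clampr 1 p.2|).

Lemma retract_continuous N : 0 <= N -> continuous (retract N).
Proof.
move=> N0.
have cclamp : continuous (clamp N : 'rV[R]_2 -> 'rV[R]_2).
  apply: (@norm_lipschitz_continuous R _ _ (clamp N : 'rV[R]_2 -> 'rV[R]_2) 1) => // u v.
  by rewrite mul1r clamp_lipschitz.
have cclampr : continuous (fun e : R => `|clampr 1 e|).
  apply: (@norm_lipschitz_continuous R _ _ (fun e : R => `|clampr 1 e|) 1) => // a b.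
  by rewrite mul1r (le_trans (ler_dist_dist _ _))// clampr_lipschitz.
move=> p.
have h1 : q.1.1 @[q --> p] --> p.1.1.
  by apply: (@cvg_comp _ _ _ fst fst (nbhs p) (nbhs p.1)); exact: cvg_fst.
have h2 : clamp N q.1.2 @[q --> p] --> clamp N p.1.2.
  apply: (@cvg_comp _ _ _ (fun p : R * 'rV[R]_2 * R => p.1.2) (clamp N) (nbhs p) (nbhs p.1.2)).
    by apply: (@cvg_comp _ _ _ fst snd (nbhs p) (nbhs p.1)); [exact: cvg_fst|exact: cvg_snd].
  exact: cclamp.
have h3 : `|clampr 1 q.2| @[q --> p] --> `|clampr 1 p.2|.
  apply: (@cvg_comp _ _ _ snd (fun e : R => `|clampr 1 e|) (nbhs p) (nbhs p.2));
    first exact: cvg_snd.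
  exact: cclampr.
exact: (cvg_pair (cvg_pair h1 h2) h3).
Qed.

(** A globally continuous map equal to [phi] for [|v| <= N] and [e] in [[0, 1]], to which the
    compactness lemmas apply. *)
Definition extend N (p : R * 'rV[R]_2 * R) : 'rV[R]_2 :=
  let q := retract N p in phi q.1.1 q.1.2 q.2.

Lemma extend_continuous N : 0 <= N -> continuous (extend N).
Proof.
move=> N0 p; have /subspace_continuousP/(_ (retract N p)) := phiC.
have rin q : 0 <= (retract N q).2 <= 1 by rewrite /= normr_ge0 clampr_norm_le.
move=> /(_ (rin p)); apply: cvg_comp.
move=> A; rewrite /within => nA.
have := @retract_continuous N N0 p _ nA.
by apply: (@filterS _ (nbhs p)) => q Aq; exact: (Aq (rin q)).
Qed.

Lemma extendE N t v e : `|v| <= N -> 0 <= e <= 1 -> extend N (t, v, e) = phi t v e.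
Proof.
move=> vN e01; rewrite /extend /= clamp_id// clampr_id; first by rewrite ger0_norm//; lra.
by rewrite ger0_norm; lra.
Qed.

Let K (a b N : R) : set (R * 'rV[R]_2 * R) :=
  (`[a, b] `*` [set v : 'rV[R]_2 | `|v| <= N]) `*` `[0, 1].

Let K_compact a b N : compact (K a b N).
Proof.
apply: compact_setX; last exact: segment_compact.
by apply: compact_setX; [exact: segment_compact|exact: compact_norm_le].
Qed.

Lemma perturbation_bounded (a b N : R) : 0 <= N -> exists2 B, 0 <= B &
  forall t v e, a <= t <= b -> `|v| <= N -> 0 <= e <= 1 -> `|phi t v e| <= B.
Proof.
move=> N0; have [B B0 phiB] :=
  compact_continuous_bounded (K_compact (a := a) (b := b) (N := N)) (extend_continuous N0).
exists B => // t v e tab vN e01; rewrite -(@extendE N)//.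
by apply: phiB; rewrite /K/= !in_itv.
Qed.

(** Compares the integrand of [f1], taken at [eps = 0] along [x0], with the actual perturbation
    along the shifted solution. *)
Lemma perturbation_unif (a b N eta : R) : 0 <= N -> 0 < eta ->
  exists2 d, 0 < d & forall t v t' v' e, a <= t <= b -> `|v| <= N -> `|v'| <= N ->
    0 <= e <= 1 -> `|t - t'| < d -> `|v - v'| < d -> e < d ->
    `|phi t v 0 - phi t' v' e| < eta.
Proof.
move=> N0 eta0.
have [d d0 phid] :=
  compact_unif_continuous (K_compact (a := a) (b := b) (N := N)) (extend_continuous N0) eta0.
exists d => // t v t' v' e tab vN v'N e01 tt' vv' ed.
have z01 : 0 <= (0 : R) <= 1 by rewrite lexx ler01.
rewrite -(extendE t vN z01) -(extendE t' v'N e01).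
apply: phid; first by rewrite /K/= !in_itv/= z01.
rewrite [X in X < _](_ : _ = Num.max (Num.max `|t - t'| `|v - v'|) `|0 - e|); last by [].
by rewrite !gt_max tt' vv' sub0r normrN ger0_norm//; lra.
Qed.

(** With [f1] an increment of a primitive, averaging over a period becomes one mean value inequality
    for [<z1, w> - eps F]. *)
Lemma f1_primitive (x0 z1 : R -> 'rV[R]_2) (T theta : R) :
  0 < T -> continuous x0 -> (exists N, forall t, `|x0 t| <= N) -> continuous z1 ->
  exists2 F : R -> R,
    forall t, is_derive t (1 : R) F (dot (z1 t) (phi (t - theta) (x0 t) 0)) &
    forall t, f1 phi x0 z1 T theta t = F t - F (t - T).
Proof.
move=> T0 cx0 [N xN] cz1; have N0 : 0 <= N by exact: le_trans (xN 0).
pose g t := dot (z1 t) (phi (t - theta) (x0 t) 0).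
have cphi : continuous (fun t => phi (t - theta) (x0 t) 0).
  have -> : (fun t => phi (t - theta) (x0 t) 0) =
      extend N \o (fun t => (t - theta, x0 t, 0)).
    by apply/funext => t /=; rewrite extendE ?lexx ?ler01.
  move=> t; apply: continuous_comp; last exact: extend_continuous.
  have h1 : s - theta @[s --> t] --> t - theta.
    by apply: cvgB; [exact: cvg_id|exact: cvg_cst].
  have h3 : (0 : R) @[s --> t] --> (0 : R) by exact: cvg_cst.
  exact: (cvg_pair (cvg_pair h1 (cx0 t)) h3).
have cg : continuous g.
  have ccoord (f : R -> 'rV[R]_2) i : continuous f -> continuous (fun t => f t 0 i).
    move=> cf t; apply: (@continuous_comp _ _ _ f (fun v => v 0 i)); first exact: cf.
    exact: coord_continuous.
  move=> t; rewrite (_ : g = fun t => z1 t 0 0 * phi (t - theta) (x0 t) 0 0 0 +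
      z1 t 0 1 * phi (t - theta) (x0 t) 0 0 1); last by apply/funext => s; rewrite /g dotE.
  by apply: cvgD; apply: cvgM; apply: (ccoord _ _ _ t).
have [F _ Fd] := scalar_primitive cg.
exists F => // t; have tT : t - T < t by lra.
have cF : continuous F by move=> s; exact: is_derive_continuous (Fd s).
rewrite /f1 /Rintegral (@continuous_FTC2 R g F (t - T) t tT).
- by [].
- exact: continuous_subspaceT.
- split; first by move=> s _; case: (Fd s).
  + by apply: cvg_at_right_filter; exact: cF.
  + by apply: cvg_at_left_filter; exact: cF.
- by move=> s _; rewrite derive1E; case: (Fd s).
Qed.

End Perturbation.

(** * Crossing the curve I(t, .) *)

Lemma is_derive_shift_comp (R : realType) (V : normedModType R) (f : R -> V) df a t :
  is_derive (a + t) (1 : R) f df -> is_derive t (1 : R) (fun s => f (a + s)) df.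
Proof.
move=> [fd fE].
have E : (fun h : R => h^-1 *:
      (((fun s => f (a + s)) \o shift t) (h *: (1 : R)) - f (a + t))) =
    (fun h : R => h^-1 *: ((f \o shift (a + t)) (h *: (1 : R)) - f (a + t))).
  by apply/funext => h /=; rewrite addrCA.
by split; [rewrite /derivable E | rewrite /derive E].
Qed.

(** In the plane the vectors orthogonal to [z] form the line of [perp z]; the value of [|r|] serves
    to check [r] against [r0]. *)
Lemma perp_decompose (R : realType) (z v : 'rV[R]_2) : z != 0 -> dot z v = 0 ->
  exists2 r, `|r| = enorm v & v = r *: ((enorm (perp z))^-1 *: perp z).
Proof.
move=> z0 zv; have p0 : (perp z) 0 0 = z 0 1 by rewrite mxE.
have p1 : (perp z) 0 1 = - z 0 0 by rewrite mxE.
have dp : dot (perp z) (perp z) = dot z z by rewrite !dotE p0 p1; ring.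
have dz0 : 0 < dot z z.
  by apply: lt_le_trans (norm_le_dot z); rewrite exprn_gt0// normr_gt0.
have n0 : 0 < enorm (perp z) by rewrite sqrtr_gt0 dp.
have n2 : enorm (perp z) ^+ 2 = dot z z by rewrite sqr_sqrtr dp// ltW.
have vE : v = (dot (perp z) v / enorm (perp z)) *: ((enorm (perp z))^-1 *: perp z).
  rewrite scalerA -mulrA -invfM -expr2 n2.
  apply: (@scalerI _ _ (dot z z)); first exact: lt0r_neq0.
  rewrite scalerA mulrCA mulfV ?mulr1 ?lt0r_neq0//.
  move: zv; rewrite !dotE p0 p1 => zv; apply/rowP => i; rewrite !mxE.
  case: i => -[|[|//]] ilt.
    rewrite (_ : Ordinal ilt = 0) ?eqxx; last exact: val_inj.
    by rewrite -[LHS]subr0 -(mulr0 (z 0 0)) -zv; ring.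
  rewrite (_ : Ordinal ilt = 1)/=; last exact: val_inj.
  by rewrite -[LHS]subr0 -(mulr0 (z 0 1)) -zv; ring.
exists (dot (perp z) v / enorm (perp z)) => //.
set r := _ / _ in vE *; rewrite vE /enorm dotZl !dotZr dotZl -/(enorm (perp z)) dp -n2.
rewrite -sqrtr_sqr; congr Num.sqrt; rewrite expr2.
by field; rewrite lt0r_neq0.
Qed.

Section Crossing.
Variables (R : realType) (psi : 'rV[R]_2 -> 'rV[R]_2) (T : R).
Variables (x0 z0 : R -> 'rV[R]_2) (N M L Z c delta : R).
Hypotheses (x0_sol : solution psi x0) (T_gt0 : 0 < T)
  (x0T : forall t, x0 (t + T) = x0 t)
  (z0_eigen : eigenfunction (adjoint psi x0) T 1 z0)
  (z0_neq0 : forall t, z0 t != 0).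
Hypotheses (L0 : 0 <= L) (M0 : 0 <= M) (Z0 : 0 <= Z)
  (xN : forall t, `|x0 t| + 1 <= N)
  (psiL : forall u v, `|u| <= N -> `|v| <= N -> `|psi u - psi v| <= L * `|u - v|)
  (psiM : forall u, `|u| <= N -> `|psi u| <= M)
  (z0Z : forall t, `|t| <= T -> `|z0 t| <= Z)
  (c_neq0 : c != 0) (z0c : forall t, dot (z0 t) (psi (x0 t)) = c).
(** [delta_c] keeps the quadratic error of [orbit_taylor], once paired with [z0], below half of the
    linear term; [delta_M] lets the orbit move by at most 1/4 in time [delta]. *)
Hypotheses (delta_gt0 : 0 < delta) (delta_c : 4 * Z * L * M * delta <= `|c|)
  (delta_M : 4 * (M * delta) <= 1).

Let N0 : 0 <= N. Proof. by have := xN 0; have := normr_ge0 (x0 0); lra. Qed.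
Let x0N t : `|x0 t| <= N. Proof. by have := xN t; lra. Qed.

(** Globally Lipschitz and bounded, so [picard] applies; it agrees with [psi] on a ball containing
    the unit tube around the orbit. *)
Definition cutoff (v : 'rV[R]_2) := psi (clamp N v).

Lemma cutoffE v : `|v| <= N -> cutoff v = psi v.
Proof. by move=> vN; rewrite /cutoff clamp_id. Qed.

Lemma cutoff_lipschitz u v : `|cutoff u - cutoff v| <= L * `|u - v|.
Proof.
rewrite (le_trans (psiL (clamp_norm_le _ N0) (clamp_norm_le _ N0)))//.
by rewrite ler_wpM2l// clamp_lipschitz.
Qed.

Lemma cutoff_bounded u : `|cutoff u| <= M.
Proof. by rewrite psiM// clamp_norm_le. Qed.

Definition flow_line (y : R -> 'rV[R]_2) :=
  forall s, is_derive s (1 : R) y (cutoff (y s)).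

Lemma flow_line_dist y y' : flow_line y -> flow_line y' ->
  forall s, `|y s - y' s| <= gron L `|s| * `|y 0 - y' 0|.
Proof.
move=> yd y'd s.
have wd r : is_derive r (1 : R) (fun r => y r - y' r) (cutoff (y r) - cutoff (y' r)).
  exact: (is_deriveB (yd r) (y'd r)).
have wle r : `|cutoff (y r) - cutoff (y' r)| <= L * `|y r - y' r| + 0.
  by rewrite addr0 cutoff_lipschitz.
by have := gronwall_both L0 (lexx 0) wd wle 0 s; rewrite subr0 addr0.
Qed.

Lemma orbit_flow_line t : flow_line (fun s => x0 (t + s)).
Proof.
by move=> s; rewrite cutoffE//; apply: is_derive_shift_comp; exact: x0_sol.
Qed.

(** The margin 1 beyond [T] is there because [Omega] asks for a solution on an open interval around
    both times. *)
Lemma flow_line_orbit y t : flow_line y -> forall s, `|s| <= T + 1 ->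
  `|y s - x0 (t + s)| <= gron L (T + 1) * `|y 0 - x0 t|.
Proof.
move=> yd s sT.
have := flow_line_dist yd (@orbit_flow_line t) s; rewrite addr0 => /le_trans; apply.
by rewrite ler_wpM2r// ler_gron.
Qed.

Lemma orbit_lipschitz s t : `|x0 s - x0 t| <= M * `|s - t|.
Proof.
wlog st : s t / t <= s => [H|].
  by case: (leP t s) => [/H//|/ltW/H]; rewrite distrC (distrC t).
rewrite ger0_norm ?subr_ge0//.
exact: (norm_derive_le st (fun r _ => x0_sol r) (fun r _ => psiM (x0N r))).
Qed.

Lemma orbit_taylor t s :
  `|x0 (t + s) - x0 t - s *: psi (x0 t)| <= L * M * s ^+ 2.
Proof.
pose f r := x0 (t + r) - r *: psi (x0 t).
have fd r : is_derive r (1 : R) f (psi (x0 (t + r)) - psi (x0 t)).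
  have h1 := is_derive_shift_comp (x0_sol (t + r)).
  exact: (is_deriveB h1 (is_derive_scale _ r)).
pose K := L * M * `|s|.
have fle r : `|r| <= `|s| -> `|psi (x0 (t + r)) - psi (x0 t)| <= K.
  move=> rs; rewrite (le_trans (psiL (x0N _) (x0N _)))// /K -mulrA ler_wpM2l//.
  rewrite (le_trans (orbit_lipschitz _ _))// ler_wpM2l//.
  by rewrite (addrC t) addrK.
have -> : x0 (t + s) - x0 t - s *: psi (x0 t) = f s - f 0.
  by rewrite /f addr0 scale0r subr0 addrAC.
rewrite -real_normK ?num_real// expr2 mulrA -/K.
case: (leP 0 s) => s0.
  rewrite [X in K * X]ger0_norm// -[X in K * X]subr0.
  apply: (norm_derive_le s0 (fun r _ => fd r)) => r /andP[r0 rs].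
  by apply: fle; rewrite !ger0_norm ?ltW// (lt_trans r0).
rewrite [X in K * X]ltr0_norm// -[X in K * X]sub0r distrC.
apply: (norm_derive_le (ltW s0) (fun r _ => fd r)) => r /andP[sr r0].
by apply: fle; rewrite !ltr0_norm// lerN2 ltW.
Qed.

(** Going back by [T] along the orbit returns to [x0 (t + s)], so [y (- T)] is near that point,
    whose displacement from [x0 t] pairs with [z0 t] to about [s * c]. *)
Lemma crossing_approx t s y eta : 0 <= t <= T -> flow_line y ->
  `|y 0 - x0 (t + s)| <= eta ->
  `|dot (z0 t) (y (- T) - x0 t) - s * c| <=
    2 * Z * (gron L (T + 1) * eta + L * M * s ^+ 2).
Proof.
move=> tT yd y0; rewrite -(z0c t) -dotZr -dotBr.
rewrite (le_trans (dot_norm_le _ _))// -mulrA -[in leRHS]mulrA ler_pM2l//.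
rewrite ler_pM//; first by rewrite z0Z// ger0_norm; lra.
have -> : y (- T) - x0 t - s *: psi (x0 t) =
    (y (- T) - x0 (t + s - T)) + (x0 (t + s) - x0 t - s *: psi (x0 t)).
  by rewrite -(x0T (t + s - T)) subrK !addrA subrK.
rewrite (le_trans (ler_normD _ _))// lerD ?orbit_taylor//.
apply: (le_trans (flow_line_orbit (t + s) yd _)).
  by rewrite normrN ger0_norm; lra.
by rewrite ler_wpM2l ?gron_ge0.
Qed.

Definition crossing (u : R -> 'rV[R]_2) t s := exists2 y, flow_line y &
  y 0 = u (t + s) /\ dot (z0 t) (y (- T) - x0 t) = 0.

Lemma crossing_exists (u : R -> 'rV[R]_2) (eta t : R) :
  continuous u -> (forall t, `|u t - x0 t| <= eta) ->
  8 * Z * (gron L (T + 1) * eta) <= `|c| * delta -> 0 <= t <= T ->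
  exists2 s, `|s| <= delta & crossing u t s.
Proof.
move=> cu ux eta_small tT.
have /choice[Y YP] : forall p, exists y, flow_line y /\ y 0 = p.
  by move=> p; have [y y0 yd] := picard p L0 M0 cutoff_lipschitz cutoff_bounded; exists y.
pose g s := dot (z0 t) (Y (u (t + s)) (- T) - x0 t).
have cg : continuous g.
  pose k (p : 'rV[R]_2) := dot (z0 t) (Y p (- T) - x0 t).
  have ck : continuous k.
    apply: (@norm_lipschitz_continuous _ _ _ k (2 * `|z0 t| * gron L T)).
      by rewrite !mulr_ge0 ?gron_ge0.
    move=> p q; rewrite /k -dotBr opprB addrA subrK.
    rewrite (le_trans (dot_norm_le _ _))// -[leRHS]mulrA ler_wpM2l ?mulr_ge0//.
    have := flow_line_dist (YP p).1 (YP q).1 (- T).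
    by rewrite normrN (gtr0_norm T_gt0) (YP p).2 (YP q).2.
  move=> s; apply: (@continuous_comp _ _ _ (fun s => u (t + s)) k); last exact: ck.
  apply: (@continuous_comp _ _ _ (fun s => t + s) u); last exact: cu.
  by apply: cvgD; [exact: cvg_cst | exact: cvg_id].
(* The eta term costs at most a quarter of [|c| * delta] and the quadratic term at most half, so [g]
   has the sign of [s * c] at both ends. *)
have gs s : `|s| = delta -> `|g s - s * c| < `|c| * delta.
  move=> sd; apply: le_lt_trans (crossing_approx (s := s) (eta := eta) tT (YP _).1 _) _.
    by rewrite (YP _).2.
  rewrite -real_normK ?num_real// sd.
  have cd : 0 < `|c| * delta by rewrite mulr_gt0// normr_gt0.
  have := ler_wpM2r (ltW delta_gt0) delta_c; rewrite /=; lra.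
have d1 := gs delta (gtr0_norm delta_gt0).
have d2 : `|g (- delta) - (- delta) * c| < `|c| * delta.
  by apply: gs; rewrite normrN gtr0_norm.
have dd : - delta <= delta by rewrite (@le_trans _ _ 0) ?oppr_le0 ?ltW.
have [|s sd gs0] := @IVT R g (- delta) delta 0 dd (continuous_subspaceT cg).
  rewrite ge_min le_max; move: d1 d2; rewrite !ltr_norml.
  have [c0|c0] := leP 0 c; rewrite ?(ger0_norm c0) ?(ltr0_norm c0) => /andP[? ?] /andP[? ?].
    by apply/andP; split; apply/orP; [left|right]; lra.
  by apply/andP; split; apply/orP; [right|left]; lra.
exists s; first by move: sd; rewrite in_itv/= -ler_norml.
by exists (Y (u (t + s))); [exact: (YP _).1 | split; [exact: (YP _).2|]].
Qed.

(** At a root the quadratic term is at most half of [|c| * |s|] and is absorbed. The bound holds for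
    every root in the interval, whichever one is chosen. *)
Lemma crossing_small (u : R -> 'rV[R]_2) (eta t s : R) :
  (forall t, `|u t - x0 t| <= eta) ->
  0 <= t <= T -> `|s| <= delta -> crossing u t s ->
  `|c| * `|s| <= 4 * Z * (gron L (T + 1) * eta).
Proof.
move=> ux tT sd [y yd [y0 yT]].
have := @crossing_approx t s y eta tT yd; rewrite y0 yT => /(_ (ux _)).
rewrite sub0r normrN normrM -(real_normK (num_real s)).
have := ler_wpM2r (normr_ge0 s) delta_c.
have : 4 * Z * L * M * `|s| * `|s| <= 4 * Z * L * M * delta * `|s|.
  by rewrite ler_wpM2r// ler_wpM2l// !mulr_ge0.
rewrite expr2; lra.
Qed.

Lemma crossing_curve (u : R -> 'rV[R]_2) (eta t s : R) :
  (forall t, `|u t - x0 t| <= eta) ->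
  4 * (gron L (T + 1) * eta) <= 1 -> 0 <= t <= T ->
  `|s| <= delta -> crossing u t s -> I_curve psi x0 z0 T t 1 (u (t + s)).
Proof.
move=> ux eta_small tT sd [y yd [y0 yT]].
have near_x0 r : `|r| <= T + 1 -> `|y r - x0 (t + s + r)| <= 1 / 4.
  move=> rT; rewrite (le_trans (flow_line_orbit (t + s) yd rT))// y0.
  have := ler_wpM2l (gron_ge0 L (T + 1)) (ux (t + s)); lra.
have yN r : `|r| <= T + 1 -> `|y r| <= N.
  move=> /near_x0 yx; have := xN (t + s + r).
  by have := ler_normD (y r - x0 (t + s + r)) (x0 (t + s + r)); rewrite subrK; lra.
have [r rE qE] := perp_decompose (z0_neq0 t) yT.
(* One quarter from following the orbit and one from the shift by [s]; with [enorm_le] this gives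
   [|r| <= 1]. *)
have qx : `|y (- T) - x0 t| <= 1 / 2.
  have TT : `|- T| <= T + 1 by rewrite normrN gtr0_norm// lerDl.
  have := near_x0 _ TT; have := orbit_lipschitz (t + s) t.
  have := ler_wpM2l M0 sd; have := delta_M; rewrite (addrC t) addrK -(x0T (s + t - T)) subrK.
  have := ler_normD (y (- T) - x0 (s + t)) (x0 (s + t) - x0 t).
  rewrite subrKA; lra.
exists r.
  by rewrite -ler_norml rE; have := enorm_le (y (- T) - x0 t); lra.
(* Delaying [y] by [T] turns the backward trajectory into a forward one from the normal line; it
   stays where the cut-off is inactive. *)
exists (- 1), (T + 1), (fun r => y (- T + r)); split.
- by have := T_gt0; lra.
- by have := T_gt0; lra.
- move=> r' r'T; apply: is_derive_shift_comp; rewrite -cutoffE; first exact: yd.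
  by apply: yN; rewrite ler_norml; lra.
- by rewrite addr0 /h -qE addrC subrK.
- by rewrite addNr.
Qed.

(** The trajectory [y] obeys the unperturbed equation, so its pairing with [z0] drifts only by the
    Taylor error. One period earlier the pairing is zero by the crossing condition and the
    periodicity of [z0] and [x0]. *)
Lemma crossing_dot_z0 (u : R -> 'rV[R]_2) (t s e d : R) :
  (forall u v, `|u| <= N -> `|v - u| <= d ->
    `|psi v - psi u - (v - u) *m jacobian psi u| <= e * `|v - u|) ->
  0 <= e -> 0 <= t <= T -> crossing u t s ->
  gron L (T + 1) * `|u (t + s) - x0 t| <= d ->
  gron L (T + 1) * `|u (t + s) - x0 t| <= 1 ->
  `|dot (z0 t) (u (t + s) - x0 t)| <=
    2 * Z * e * gron L (T + 1) * `|u (t + s) - x0 t| * T.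
Proof.
move=> taylor e0 tT [y yd [y0 yT]]; rewrite -y0.
have [z0_sol _ z0T] := z0_eigen.
set X := _ * `|_| => Xd X1.
have near_x0 r : t - T <= r <= t -> `|y (- t + r) - x0 r| <= X.
  move=> rT; have : `|- t + r| <= T + 1 by rewrite ler_norml; lra.
  by move=> /(flow_line_orbit t yd); rewrite addrA subrr add0r.
pose F r := dot (z0 r) (y (- t + r) - x0 r).
have Fd r : is_derive r (1 : R) F (dot (z0 r) (cutoff (y (- t + r)) - psi (x0 r) -
    (y (- t + r) - x0 r) *m jacobian psi (x0 r))).
  apply: (is_derive_adjoint_dot z0_sol (w := fun r => y (- t + r) - x0 r)).
  exact: (is_deriveB (is_derive_shift_comp (yd (- t + r))) (x0_sol r)).
pose K := 2 * Z * (e * X).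
have Fle r : t - T < r < t -> `|dot (z0 r) (cutoff (y (- t + r)) - psi (x0 r) -
    (y (- t + r) - x0 r) *m jacobian psi (x0 r))| <= K.
  move=> rT; have yx : `|y (- t + r) - x0 r| <= X by apply: near_x0; lra.
  rewrite (le_trans (dot_norm_le _ _))// /K -!mulrA ler_pM2l// ler_pM//.
    by rewrite z0Z// ler_norml; lra.
  rewrite cutoffE; last first.
    have := xN r; have := ler_normD (y (- t + r) - x0 r) (x0 r).
    by rewrite subrK; lra.
  rewrite (le_trans (taylor _ _ (x0N r) _)) ?ler_wpM2l//.
  exact: le_trans Xd.
have tT' : t - T <= t by have := T_gt0; lra.
have := abs_derive_le tT' (fun r _ => Fd r) Fle.
have -> : F (t - T) = 0.
  rewrite /F -(x0T (t - T)) -[z0 (t - T)]scale1r -z0T subrK.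
  by rewrite addrA addNr add0r.
rewrite /F addNr subr0 (_ : t - (t - T) = T); last by ring.
by rewrite /K /X !mulrA.
Qed.

End Crossing.

(** * Averaging over a period *)

Section Estimates.
Variables (R : realType) (psi : 'rV[R]_2 -> 'rV[R]_2).
Variables (phi : R -> 'rV[R]_2 -> R -> 'rV[R]_2).
Variables (T theta N L B Z rho : R) (x0 z1 : R -> 'rV[R]_2).
Hypotheses (x0_sol : solution psi x0) (T_gt0 : 0 < T)
  (x0T : forall t, x0 (t + T) = x0 t) (theta_in : 0 <= theta <= T)
  (z1_eigen : eigenfunction (adjoint psi x0) T rho z1).
Hypotheses (L0 : 0 <= L) (B0 : 0 <= B) (Z0 : 0 <= Z)
  (xN : forall t, `|x0 t| + 1 <= N)
  (psiL : forall u v, `|u| <= N -> `|v| <= N -> `|psi u - psi v| <= L * `|u - v|)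
  (z1Z : forall t, `|t| <= T -> `|z1 t| <= Z)
  (phiB : forall t v e, - (2 * T + 1) <= t <= 2 * T + 1 -> `|v| <= N ->
     0 <= e <= 1 -> `|phi t v e| <= B).

Variables (u : R -> 'rV[R]_2) (eps : R).
Hypotheses (eps01 : 0 <= eps <= 1) (uT : forall t, u (t + T) = u t)
  (u_sol : forall t, is_derive t (1 : R) u
     (psi (u t) + eps *: phi (t - theta) (u t) eps)).

Let near_orbit_N (v : 'rV[R]_2) t : `|v - x0 t| <= 1 -> `|v| <= N.
Proof.
by move=> vx; have := xN t; have := ler_normD (v - x0 t) (x0 t); rewrite subrK; lra.
Qed.

Let dwle v r t : `|v - x0 t| <= 1 -> - (2 * T + 1) <= r <= 2 * T + 1 ->
  `|psi v + eps *: phi r v eps - psi (x0 t)| <= L * `|v - x0 t| + eps * B.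
Proof.
move=> vx rT; have vN := near_orbit_N vx.
rewrite addrAC (le_trans (ler_normD _ _))// lerD ?psiL//.
  by have := xN t; lra.
by case/andP: (eps01) => e0 _; rewrite normrZ ger0_norm// ler_wpM2l// phiB.
Qed.

(** The Lipschitz and [phi] bounds are used only in the unit tube, hence the bootstrap; one period
    suffices as [u] and [x0] are periodic. *)
Lemma perturbed_close : gron L T * (`|u 0 - x0 0| + eps * B) < 1 ->
  forall t, `|u t - x0 t| <= gron L T * (`|u 0 - x0 0| + eps * B).
Proof.
move=> small t; case/andP: (eps01) => e0 e1.
have [s sT ->] : exists2 s, 0 <= s <= T & u t - x0 t = u s - x0 s.
  apply: (periodic_reduce (f := fun t => u t - x0 t) t T_gt0) => r.
  by rewrite uT x0T.
have wd r : is_derive r (1 : R) (fun r => u r - x0 r)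
    (psi (u r) + eps *: phi (r - theta) (u r) eps - psi (x0 r)).
  exact: (is_deriveB (u_sol r) (x0_sol r)).
have eB : 0 <= eps * B by rewrite mulr_ge0.
have wle r : 0 <= r <= T -> `|u r - x0 r| <= 1 ->
    `|psi (u r) + eps *: phi (r - theta) (u r) eps - psi (x0 r)| <=
      L * `|u r - x0 r| + eps * B.
  by move=> rT ux; apply: dwle => //; have := theta_in; have := T_gt0; lra.
have := gronwall_bootstrap L0 eB wd wle.
by rewrite subr0; apply.
Qed.

(** Subtracting [eps *: F] removes the leading part of the derivative of [<z1, w>], and
    [F t = F (t - T)] makes this invisible in the increment over a period. *)
Lemma averaged_dot (F : R -> R) (t s e d e1 d1 : R) :
  (forall r, is_derive r (1 : R) F (dot (z1 r) (phi (r - theta) (x0 r) 0))) ->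
  F t = F (t - T) -> 0 <= t <= T -> `|s| <= 1 -> `|s| < d1 -> eps < d1 -> 0 <= e ->
  (forall u v, `|u| <= N -> `|v - u| <= d ->
    `|psi v - psi u - (v - u) *m jacobian psi u| <= e * `|v - u|) ->
  (forall t v t' v' e', - (2 * T + 1) <= t <= 2 * T + 1 -> `|v| <= N ->
    `|v'| <= N -> 0 <= e' <= 1 -> `|t - t'| < d1 -> `|v - v'| < d1 -> e' < d1 ->
    `|phi t v 0 - phi t' v' e'| < e1) ->
  (forall r, `|u (s + r) - x0 r| <= 1 /\ `|u (s + r) - x0 r| <= d /\
     `|u (s + r) - x0 r| < d1) ->
  `|rho - 1| * `|dot (z1 t) (u (s + t) - x0 t)| <=
    `|rho| * (2 * Z * (e * (gron L T * (`|u (s + t) - x0 t| + eps * B)) + eps * e1) * T).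
Proof.
move=> Fd FT tT s1 sd1 ed1 e0 taylor phiu wsmall.
have [z1_sol _ z1T] := z1_eigen; case/andP: (eps01) => eps0 eps1.
have tT' : t - T <= t by have := T_gt0; lra.
pose w r := u (s + r) - x0 r.
have wT : w (t - T) = w t.
  by rewrite /w -(uT (s + (t - T))) -(x0T (t - T)) -addrA !subrK.
pose dw r := psi (u (s + r)) + eps *: phi (s + r - theta) (u (s + r)) eps - psi (x0 r).
have wd r : is_derive r (1 : R) w (dw r).
  exact: (is_deriveB (is_derive_shift_comp (u_sol (s + r))) (x0_sol r)).
(* The lower end is reached since [r >= - T], [theta <= T] and [|s| <= 1]; this dictates the time
   interval for [phiB]. *)
have s_r r : t - T <= r <= t -> - (2 * T + 1) <= s + r - theta <= 2 * T + 1.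
  by move=> rT; move: s1; rewrite ler_norml; have := theta_in; have := T_gt0; lra.
have eB : 0 <= eps * B by rewrite mulr_ge0.
(* Starting at [t - T], where [w] equals [w t], bounds [w] on the whole period by its value at [t];
   the error is thus relative to [|w t|]. *)
have wle r : t - T <= r <= t -> `|w r| <= gron L T * (`|w t| + eps * B).
  move=> /andP[tr rt].
  apply: (@le_trans _ _ (gron L (r - (t - T)) * (`|w t| + eps * B))); last first.
    by rewrite ler_wpM2r ?addr_ge0// ler_gron//; lra.
  rewrite -wT; apply: (gronwall tr L0 eB (fun r _ => wd r)) => q qr.
  by apply: dwle; [exact: (wsmall q).1 | apply: s_r; lra].
pose H := (fun r => dot (z1 r) (w r)) - eps *: F.
have Hd r : is_derive r (1 : R) H (dot (z1 r) (dw r - w r *m jacobian psi (x0 r)) -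
    eps * dot (z1 r) (phi (r - theta) (x0 r) 0)).
  exact: (is_deriveB (is_derive_adjoint_dot z1_sol (wd r)) (is_deriveZ eps (Fd r))).
pose K := 2 * Z * (e * (gron L T * (`|w t| + eps * B)) + eps * e1).
have Hle r : t - T < r < t -> `|dot (z1 r) (dw r - w r *m jacobian psi (x0 r)) -
    eps * dot (z1 r) (phi (r - theta) (x0 r) 0)| <= K.
  move=> rT; have [w1 [wdd wd1]] := wsmall r.
  have x0N : `|x0 r| <= N by have := xN r; lra.
  have uN := near_orbit_N w1.
  have rT' : t - T <= r <= t by lra.
  rewrite -dotZr -dotBr (le_trans (dot_norm_le _ _))// /K.
  rewrite -mulrA -[leRHS]mulrA ler_pM2l// ler_pM//.
    by rewrite z1Z// ler_norml; lra.
  have -> : dw r - w r *m jacobian psi (x0 r) - eps *: phi (r - theta) (x0 r) 0 =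
      (psi (u (s + r)) - psi (x0 r) - w r *m jacobian psi (x0 r)) -
      eps *: (phi (r - theta) (x0 r) 0 - phi (s + r - theta) (u (s + r)) eps).
    by rewrite /dw scalerBr opprB; apply/rowP => i; rewrite !mxE; ring.
  rewrite (le_trans (ler_normB _ _))// lerD//.
    rewrite (le_trans (taylor _ _ x0N wdd))// ler_wpM2l//; exact: wle.
  rewrite normrZ ger0_norm// ler_wpM2l// ltW//; apply: phiu => //.
  - by have := theta_in; have := T_gt0; lra.
  - by rewrite (_ : r - theta - _ = - s) ?normrN//; ring.
  - by rewrite distrC.
have := abs_derive_le tT' (fun r _ => Hd r) Hle.
rewrite /H !fctE FT wT opprB addrA subrK (_ : t - (t - T) = T); last by ring.
move=> HK; rewrite -normrM -/(w t).
(* The increment over a period is [(1 - 1/rho)] times the pairing; multiplying by [rho] avoids the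
   division. *)
have -> : (rho - 1) * dot (z1 t) (w t) = rho * (dot (z1 t) (w t) - dot (z1 (t - T)) (w t)).
  have zE : dot (z1 t) (w t) = rho * dot (z1 (t - T)) (w t).
    by rewrite -dotZl -z1T subrK.
  by rewrite mulrBr -zE; ring.
by rewrite normrM ler_wpM2l.
Qed.

End Estimates.

(** * Choice of constants and conclusion *)

Lemma exists_small2 (R : realType) (A1 A2 d1 d2 : R) :
  0 <= A1 -> 0 <= A2 -> 0 < d1 -> 0 < d2 ->
  exists e, [/\ 0 < e, A1 * e <= d1 & A2 * e <= d2].
Proof.
move=> A10 A20 d10 d20; have [A1p A2p] : 0 < A1 + 1 /\ 0 < A2 + 1 by lra.
have e1 : 0 < d1 / (A1 + 1) by rewrite divr_gt0.
have e2 : 0 < d2 / (A2 + 1) by rewrite divr_gt0.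
exists (Num.min (d1 / (A1 + 1)) (d2 / (A2 + 1))); split.
- by rewrite lt_min e1 e2.
- rewrite (@le_trans _ _ (A1 * (d1 / (A1 + 1))))//.
    by rewrite ler_wpM2l// ge_min lexx.
  by rewrite mulrA ler_pdivrMr//; nra.
- rewrite (@le_trans _ _ (A2 * (d2 / (A2 + 1))))//.
    by rewrite ler_wpM2l// ge_min lexx orbT.
  by rewrite mulrA ler_pdivrMr//; nra.
Qed.

(** Here [eta] bounds [u - x0], [P * eta] the shift [s], and [eta + M * (P * eta)] the shifted
    difference; a single [q] dominates all three and meets every smallness demand. *)
Lemma exists_radii (R : realType) (M P G d d1 eta1 : R) :
  0 <= M -> 0 <= P -> 0 <= G -> 0 < d -> 0 < d1 -> 0 < eta1 ->
  exists eta q, [/\ 0 < eta <= eta1, eta <= q, P * eta <= q,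
    eta + M * (P * eta) <= q &
    [/\ q <= 1, q <= d, q < d1, G * q <= 1 & G * q <= d]].
Proof.
move=> M0 P0 G0 d0 d10 eta10.
have min0 : 0 < Num.min 1 (Num.min d d1) by rewrite !lt_min ltr01 d0 d10.
have min1 : Num.min 1 (Num.min d d1) <= 1 by rewrite ge_min lexx.
have mind : Num.min 1 (Num.min d d1) <= d by rewrite !ge_min lexx !orbT.
have mind1 : Num.min 1 (Num.min d d1) <= d1 by rewrite !ge_min lexx !orbT.
move: (Num.min 1 _) min0 min1 mind mind1 => m m0 m1 md md1.
have MP0 := mulr_ge0 M0 P0; pose Q := 1 + P + M * P.
have Q0 : 0 <= Q by rewrite /Q; lra.
have GQ0 : 0 <= (1 + G) * Q by rewrite mulr_ge0// addr_ge0.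
have m20 : 0 < m / 2 by rewrite divr_gt0.
have [eta [eta0]] := exists_small2 GQ0 (@ler01 R) m20 eta10.
rewrite mul1r => Qeta eta_eta1; exists eta, (Q * eta).
have q0 : 0 <= Q * eta by rewrite mulr_ge0// ltW.
have := mulr_ge0 P0 (ltW eta0); have := mulr_ge0 MP0 (ltW eta0).
by have := mulr_ge0 G0 q0; move: Qeta q0; rewrite /Q; split; [| | | |split]; lra.
Qed.

(** Half of [a] moves to the left; the [eps / 4] leaves room for the factor 2 of [enorm_le]. *)
Lemma absorb_half (R : realFieldType) (a A1 A2 eps eta : R) :
  0 <= a -> 0 <= eps -> A1 <= 1 / 2 -> A2 <= eta ->
  a <= A1 * a + A2 * (eps / 4) -> 2 * a <= eta * eps.
Proof.
by move=> a0 eps0 A1h A2h; have := ler_wpM2r a0 A1h; have := ler_wpM2r eps0 A2h => /=; lra.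
Qed.

Theorem corollary1 (R : realType)
  (psi : 'rV[R]_2 -> 'rV[R]_2) (phi : R -> 'rV[R]_2 -> R -> 'rV[R]_2)
  (T : R) (x0 z0 z1 : R -> 'rV[R]_2) (rho : R)
  (theta0 : R) (x : R -> R -> 'rV[R]_2)
  (psiC1 : C1 psi)
  (phiC : {within [set p : R * 'rV[R]_2 * R | 0 <= p.2 <= 1],
             continuous (fun p : R * 'rV[R]_2 * R => phi p.1.1 p.1.2 p.2)})
  (phiT : forall (t : R) (v : 'rV[R]_2) (eps : R), 0 <= eps <= 1 -> phi (t + T) v eps = phi t v eps)
  (x0_cycle : limit_cycle psi T x0)
  (one_simple : simple_multiplier (linearized psi x0) T 1)
  (z0_eigen : eigenfunction (adjoint psi x0) T 1 z0)
  (rho_neq1 : rho != 1)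
  (z1_eigen : eigenfunction (adjoint psi x0) T rho z1)
  (theta0_in : 0 <= theta0 <= T)
  (x_sol : \forall eps \near (0 : R)^'+,
     (forall t : R, is_derive t (1 : R) (x eps)
                  (psi (x eps t) + eps *: phi t (x eps t) eps)) /\
     periodic (x eps) T)
  (x_cvg : forall t : R, 0 <= t <= T ->
     x eps (t - theta0) @[eps --> (0 : R)^'+] --> x0 t) :
  exists (eps0 r0 : R) (theta : R -> R -> R),
    [/\ 0 < eps0, 0 < r0 <= 1,
        (* || x_eps (t - theta_eps t) - x0 t || = o(eps), uniformly in t *)
        forall eta : R, 0 < eta ->
          \forall eps \near (0 : R)^'+,
            forall t : R, 0 <= t <= T -> f1 phi x0 z1 T theta0 t = 0 ->
              enorm (x eps (t - theta eps t) - x0 t) <= eta * eps,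
        forall t : R, 0 <= t <= T -> f1 phi x0 z1 T theta0 t = 0 ->
          theta eps t @[eps --> (0 : R)^'+] --> theta0
      & forall eps t : R, 0 < eps < eps0 ->
          0 <= t <= T -> f1 phi x0 z1 T theta0 t = 0 ->
          I_curve psi x0 z0 T t r0 (x eps (t - theta eps t))].
Proof.
have [orbit [U _]] := x0_cycle; have [x0_sol T_gt0 x0T _] := orbit.
have cx0 : continuous x0 by move=> t; exact: is_derive_continuous (x0_sol t).
have [N' N'0 xN'] := orbit_bounded orbit.
pose N := N' + 1; have N0 : 0 <= N by rewrite /N; lra.
have xN t : `|x0 t| + 1 <= N by rewrite lerD2r xN'.
have [L L0 psiL] := C1_lipschitz_box psiC1 N.
have cpsi : continuous psi by move=> p; exact: differentiable_continuous (psiC1.1 p).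
have [M M0 psiM] := compact_continuous_bounded (compact_norm_le (n := 2) (N := N)) cpsi.
have [Z Z0 zZ] := eigen_bounded z0_eigen z1_eigen.
have z0Z t tT := (zZ t tT).1; have z1Z t tT := (zZ t tT).2.
have [c c_neq0 z0c] := eigen_dot_field0 psiC1 orbit rho_neq1 z0_eigen z1_eigen.
have [C C0 zC] := eigen_solve psiC1 orbit rho_neq1 z0_eigen z1_eigen.
have z0_neq0 := eigenfunction_neq0 psiC1 orbit z0_eigen.
have [z1_sol _ _] := z1_eigen.
have cz1 : continuous z1 by move=> t; exact: is_derive_continuous (z1_sol t).
have [B B0 phiB] := perturbation_bounded phiC (- (2 * T + 1)) (2 * T + 1) N0.
have [F Fd fF] := @f1_primitive R phi phiC x0 z1 T theta0 T_gt0 cx0 (ex_intro _ N' xN') cz1.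
have nc0 : 0 < `|c| by rewrite normr_gt0.
have M40 : 0 <= 4 * M + 1 by lra.
have ZLM0 : 0 <= 4 * Z * L * M by rewrite !mulr_ge0.
(* The coefficient [4 * M + 1] yields both [4 * (M * delta) <= 1] and [delta <= 1]. *)
have [delta [delta_gt0 delta_c delta_M1]] := exists_small2 ZLM0 M40 nc0 (@ltr01 R).
have M_delta : 0 <= M * delta by rewrite mulr_ge0// ltW.
have delta_M : 4 * (M * delta) <= 1 by lra.
have delta1 : delta <= 1 by lra.
pose G := gron L (T + 1); have G0 : 0 <= G by exact: gron_ge0.
have GT : gron L T <= G by rewrite ler_gron// lerDl.
pose u eps t := x eps (t - theta0).
pose good eta eps := [/\ 0 < eps < eta /\ eps <= 1,
  forall t, is_derive t (1 : R) (u eps)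
    (psi (u eps t) + eps *: phi (t - theta0) (u eps t) eps),
  forall t, u eps (t + T) = u eps t & forall t, `|u eps t - x0 t| <= eta].
have near_good eta : 0 < eta -> \forall eps \near (0 : R)^'+, good eta eps.
  move=> eta0.
  (* The factor 2 makes the Gronwall bound at most 1/2, hence strictly below 1 as the bootstrap
     demands. *)
  have [eta1 [eta10 Geta Beta]] : exists e, [/\ 0 < e,
      (gron L T * (1 + B)) * e <= eta & (2 * (gron L T * (1 + B))) * e <= 1].
    by apply: exists_small2; rewrite ?mulr_ge0 ?gron_ge0 ?addr_ge0.
  near=> eps; have eps0 : 0 < eps by near: eps; exact: nbhs_right_gt.
  have eps1 : eps <= 1 by near: eps; exact: nbhs_right_le.
  have epseta : eps < eta by near: eps; exact: nbhs_right_lt.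
  have epseta1 : eps <= eta1 by near: eps; exact: nbhs_right_le.
  have [xsol xper] : (forall t, is_derive t (1 : R) (x eps)
      (psi (x eps t) + eps *: phi t (x eps t) eps)) /\ periodic (x eps) T.
    by near: eps; exact: x_sol.
  have u_sol t : is_derive t (1 : R) (u eps)
      (psi (u eps t) + eps *: phi (t - theta0) (u eps t) eps).
    have E : u eps = (fun t => x eps (- theta0 + t)).
      by apply/funext => s; rewrite /u addrC.
    rewrite [X in is_derive _ _ X _]E /u (addrC t); apply: is_derive_shift_comp; exact: xsol.
  have uT t : u eps (t + T) = u eps t by rewrite /u addrAC xper.
  have u00 : `|u eps 0 - x0 0| <= eta1.
    rewrite distrC; near: eps; apply: cvgr_dist_le => //; apply: x_cvg.
    by rewrite lexx ltW.
  have bnd : gron L T * (`|u eps 0 - x0 0| + eps * B) <= gron L T * (1 + B) * eta1.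
    rewrite -[leRHS]mulrA ler_wpM2l ?gron_ge0// mulrDl mul1r lerD//.
    by rewrite mulrC ler_wpM2l.
  have eps01 : 0 <= eps <= 1 by rewrite eps1 ltW.
  have small : gron L T * (`|u eps 0 - x0 0| + eps * B) < 1 by lra.
  split=> //; first by rewrite eps0 epseta.
  move=> t; apply: le_trans (le_trans bnd Geta).
  exact: (perturbed_close x0_sol T_gt0 x0T theta0_in L0 B0 xN psiL phiB eps01 uT u_sol small t).
pose cross_at := crossing psi T x0 z0 N.
(* The shift depends on [(eps, t)] only, with default value 0 where no crossing exists. *)
have /choice[S SP] : forall p : R * R, exists s,
    (exists2 s, `|s| <= delta & cross_at (u p.1) p.2 s) ->
    `|s| <= delta /\ cross_at (u p.1) p.2 s.
  move=> p; have [[s sd sc]|ns] :=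
    pselect (exists2 s, `|s| <= delta & cross_at (u p.1) p.2 s); first by exists s.
  by exists 0.
pose s eps t := S (eps, t).
have xu eps t : x eps (t - (theta0 - s eps t)) = u eps (t + s eps t).
  by rewrite /u opprB addrA.
have cdelta : 0 < `|c| * delta by rewrite mulr_gt0.
(* Closeness [eta1] is what existence of a crossing and membership in the curve require; it fixes
   [eps0]. *)
have [eta1 [eta10 Zeta1 Geta1]] : exists e, [/\ 0 < e,
    (8 * Z * G) * e <= `|c| * delta & (4 * G) * e <= 1].
  by apply: exists_small2 => //; rewrite !mulr_ge0.
have good_cross eta eps t : eta <= eta1 -> good eta eps -> 0 <= t <= T ->
    [/\ `|s eps t| <= delta, cross_at (u eps) t (s eps t) &
       `|c| * `|s eps t| <= 4 * Z * (G * eta)].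
  move=> eta_eta1 [_ u_sol uT ux] tT.
  have cu : continuous (u eps) by move=> r; exact: is_derive_continuous (u_sol r).
  have Zeta : 8 * Z * (G * eta) <= `|c| * delta.
    by apply: le_trans Zeta1; rewrite mulrA ler_wpM2l// !mulr_ge0.
  have [|sd sc] := SP (eps, t).
    exact: (crossing_exists x0_sol T_gt0 x0T L0 M0 xN psiL psiM z0Z c_neq0 z0c
      delta_gt0 delta_c cu ux Zeta tT).
  split; [exact: sd | exact: sc |].
  exact: (crossing_small x0_sol x0T L0 M0 Z0 xN psiL psiM z0Z z0c
      delta_c ux tT sd sc).
have [eps0 eps0_gt0 goodP] : exists2 eps0, 0 < eps0 &
    forall eps, 0 < eps < eps0 -> good eta1 eps.
  have [eps0 /= eps00 H] := near_good eta1 eta10.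
  exists eps0 => // eps /andP[e0 ee]; apply: H => //=.
  by rewrite sub0r normrN gtr0_norm.
exists eps0, 1, (fun eps t => theta0 - s eps t); split => //.
- by rewrite ltr01 lexx.
- move=> eta eta0; pose kappa := `|rho| / `|rho - 1|.
  have r1 : 0 < `|rho - 1| by rewrite normr_gt0 subr_eq0.
  have k0 : 0 <= kappa by rewrite divr_ge0.
  pose D := 2 * C * Z * T.
  have D0 : 0 <= D by rewrite !mulr_ge0// ltW.
  (* [e] is the accuracy of both the Taylor bound and the continuity of [phi]. The two coefficients
     are those of [|w|] and [eps / 4] in the final inequality. *)
  have [e [e0 De1 De2]] : exists e, [/\ 0 < e, (D * G * (1 + kappa)) * e <= 1 / 2 &
      (4 * D * kappa * (G * B + 1)) * e <= eta].
    apply: exists_small2 => //.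
      by rewrite (mulr_ge0 (mulr_ge0 D0 G0))// addr_ge0.
    by rewrite (mulr_ge0 (mulr_ge0 (mulr_ge0 _ D0) k0))// addr_ge0// mulr_ge0.
  have [d d0 taylor] := C1_taylor_unif psiC1 N e0.
  have [d1 d10 phi_unif] := perturbation_unif phiC (- (2 * T + 1)) (2 * T + 1) N0 e0.
  (* This is the ratio of [|s|] to the closeness of [u] and [x0] given by [crossing_small]. *)
  have P0 : 0 <= 4 * Z * G / `|c| by rewrite divr_ge0// !mulr_ge0.
  have [eta2 [q [/andP[eta20 eta21] eta2q Pq MPq [q1 qd qd1 Gq1 Gqd]]]] :=
    exists_radii M0 P0 G0 d0 d10 eta10.
  near=> eps.
  have good_eps : good eta2 eps by near: eps; exact: near_good.
  move=> t tT f1t; rewrite xu.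
  have [sd sc sP] := good_cross _ _ t eta21 good_eps tT.
  have {}sP : `|s eps t| <= 4 * Z * G / `|c| * eta2.
    rewrite mulrAC ler_pdivlMr// mulrC; apply: le_trans sP _; by rewrite !mulrA.
  have [[/andP[eps_gt0 eps_eta] eps1] u_sol uT ux] := good_eps.
  have eps01 : 0 <= eps <= 1 by rewrite eps1 ltW.
  have wq r : `|u eps (s eps t + r) - x0 r| <= q.
    apply: le_trans MPq; rewrite -(subrKA (x0 (s eps t + r))).
    rewrite (le_trans (ler_normD _ _))// lerD ?ux//.
    rewrite (le_trans (orbit_lipschitz x0_sol xN psiM _ _))// addrK.
    by rewrite ler_wpM2l.
  have wsmall r : `|u eps (s eps t + r) - x0 r| <= 1 /\
      `|u eps (s eps t + r) - x0 r| <= d /\ `|u eps (s eps t + r) - x0 r| < d1.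
    by split; [|split]; [exact: le_trans q1|exact: le_trans qd|exact: le_lt_trans qd1].
  have F1 : F t = F (t - T) by apply/subr0_eq; rewrite -fF f1t.
  have sq : `|s eps t| <= q := le_trans sP Pq.
  have s1 := le_trans sq q1; have s_d1 := le_lt_trans sq qd1.
  have eps_d1 := lt_trans (lt_le_trans eps_eta eta2q) qd1.
  have w1 := averaged_dot x0_sol T_gt0 x0T theta0_in z1_eigen L0 B0 xN psiL z1Z phiB
    eps01 uT u_sol Fd F1 tT s1 s_d1 eps_d1 (ltW e0) taylor phi_unif wsmall.
  have Gwq : G * `|u eps (t + s eps t) - x0 t| <= G * q.
    by rewrite ler_wpM2l// (addrC t).
  have w0 := crossing_dot_z0 x0_sol T_gt0 x0T z0_eigen L0 xN psiL z0Z taylor (ltW e0) tT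
    sc (le_trans Gwq Gqd) (le_trans Gwq Gq1).
  have wC := zC t (u eps (t + s eps t) - x0 t) tT.
  apply: (le_trans (enorm_le _)).
  move: wC w0 w1; rewrite (addrC (s eps t)).
  set w := u eps _ - x0 t; set a := `|w|; set p0 := `|dot (z0 t) w|; set p1 := `|dot (z1 t) w|.
  rewrite -/G => wC w0 w1.
  have a0 : 0 <= a by exact: normr_ge0.
  pose X := 2 * Z * (e * (G * (a + eps * B)) + eps * e) * T.
  have {}w1 : p1 <= kappa * X.
    rewrite /kappa mulrAC ler_pdivlMr// mulrC (le_trans w1)// ler_wpM2l//.
    rewrite /X ler_wpM2r ?(ltW T_gt0)// ler_wpM2l ?mulr_ge0// lerD2r ler_wpM2l ?(ltW e0)//.
    by rewrite ler_wpM2r// addr_ge0// mulr_ge0// ltW.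
  have {}wC : a <= C * (2 * Z * e * G * a * T + kappa * X).
    by rewrite (le_trans wC)// ler_wpM2l ?(ltW C0)// lerD.
  have E : C * (2 * Z * e * G * a * T + kappa * X) =
      D * G * (1 + kappa) * e * a + (4 * D * kappa * (G * B + 1)) * e * (eps / 4).
    by rewrite /D /X; field.
  by apply: (absorb_half a0 (ltW eps_gt0) De1 De2); rewrite -E.
- move=> t tT _; apply/cvgrPdist_le => eta eta0.
  have P0 : 0 <= 4 * Z * G by rewrite !mulr_ge0.
  have ceta : 0 < `|c| * eta by rewrite mulr_gt0.
  have [eta2 [eta20 Peta2 eta21]] := exists_small2 P0 (@ler01 R) ceta eta10.
  rewrite mul1r in eta21.
  near=> eps; have good_eps : good eta2 eps by near: eps; exact: near_good.
  have [_ _ sP] := good_cross _ _ t eta21 good_eps tT.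
  rewrite opprB addrC subrK -(ler_pM2l nc0) (le_trans sP)//.
  by rewrite mulrA.
- move=> eps t epsP tT _; rewrite xu.
  have good_eps := goodP eps epsP; have [_ _ _ ux] := good_eps.
  have [sd sc _] := good_cross _ _ t (lexx _) good_eps tT.
  have Geta : 4 * (gron L (T + 1) * eta1) <= 1 by rewrite mulrA.
  exact: (crossing_curve x0_sol T_gt0 x0T z0_neq0 L0 M0 xN psiL psiM delta_M ux Geta tT sd sc).
Unshelve. all: by end_near. Qed.
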